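(* Fix $d\in\mathbb{N}$. Let $\{X_n\}$ and $\{Y_n\}$ be sequences of $n\times d$ random matrices, where $Y_n\sim\mathsf{N}(0,\Sigma_n\otimes\mathrm{I}_n)$ (i.e., the rows of $Y_n$ are i.i.d. $\mathsf{N}(0,\Sigma_n)$) for positive semidefinite $d\times d$ matrices $\Sigma_n$ with $\sup_n\|\Sigma_n\|_{op}<\infty$. The following are equivalent: (i) there exists a sequence of couplings of $(X_n,Y_n)$ such that $\frac{\|X_n-Y_n\|_F}{\sqrt n}\xrightarrow[n\to\infty]{\mathrm{p}}0$; (ii) for every $r\ge1$ and every sequence of functions $\psi_n\colon\mathbb{R}^{n\times d}\to\mathbb{R}$ satisfying $$|\psi_n(X)-\psi_n(Y)|\le\frac{\|X-Y\|_F}{\sqrt n}\Big(1+\Big(\frac{\|X\|_F}{\sqrt n}\Big)^{r-1}+\Big(\frac{\|Y\|_F}{\sqrt n}\Big)^{r-1}\Big)\quad\text{for all }X,Y\in\mathbb{R}^{n\times d},$$ one has $|\psi_n(X_n)-\mathbb{E}[\psi_n(Y_n)]|\xrightarrow[n\to\infty]{\mathrm{p}}0$.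
   Context: $\|\cdot\|_F$ is the Frobenius norm. A coupling of $(X_n,Y_n)$ is a joint distribution on a common probability space with the given marginal laws. *)

(* Defs.v *)
From HB Require Import structures.
From mathcomp Require Import all_boot all_order all_algebra.
From mathcomp Require Import all_classical all_reals all_analysis.
Set Implicit Arguments. Unset Strict Implicit. Unset Printing Implicit Defensive.
Import Order.TTheory GRing.Theory Num.Theory.
Import numFieldNormedType.Exports.
Local Open Scope classical_set_scope.
Local Open Scope ring_scope.

Section defs.
Variable R : realType.

Definition frob (m k : nat) (M : 'M[R]_(m, k)) : R :=
  Num.sqrt (\sum_(i < m) \sum_(j < k) M i j ^+ 2).

Definition vnorm (k : nat) (v : 'cV[R]_k) : R :=
  Num.sqrt (\sum_(i < k) v i 0 ^+ 2).

(* Borel sigma-algebra on R^{m x k}: generated by the coordinate maps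
   (equal to the Borel sigma-algebra of the Euclidean topology). *)
Definition mx_borel (m k : nat) : set (set 'M[R]_(m, k)) :=
  <<s [set A | exists (i : 'I_m) (j : 'I_k) (B : set R),
               measurable B /\ A = (fun M : 'M[R]_(m, k) => M i j) @^-1` B] >>.

Definition random_mx d (T : measurableType d) (m k : nat)
  (X : T -> 'M[R]_(m, k)) : Prop :=
  forall (i : 'I_m) (j : 'I_k), measurable_fun [set: T] (fun w => X w i j).

Definition same_law d (T : measurableType d) (P : probability T R)
  d' (T' : measurableType d') (P' : probability T' R) (m k : nat)
  (X : T -> 'M[R]_(m, k)) (X' : T' -> 'M[R]_(m, k)) : Prop :=
  forall A, mx_borel A -> P (X @^-1` A) = P' (X' @^-1` A).

Definition centered_normal (v : R) : set R -> \bar R :=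
  if v == 0 then \d_(0 : R) else normal_prob 0 (Num.sqrt v).

(* Y ~ N(0, Sigma (x) I_m): a centered Gaussian m x k random matrix whose
   rows are i.i.d. N(0, Sigma); equivalently (definition of a Gaussian vector)
   every linear functional <A, Y> = sum_ij A_ij Y_ij is N(0, sum_i a_i Sigma a_i^T)
   where a_i is the i-th row of A. *)
Definition gaussian_mx d (T : measurableType d) (P : probability T R)
  (m k : nat) (Sigma : 'M[R]_k) (Y : T -> 'M[R]_(m, k)) : Prop :=
  random_mx Y /\
  forall A : 'M[R]_(m, k),
    let v := \sum_(i < m) (row i A *m Sigma *m (row i A)^T) 0 0 in
    forall B : set R, measurable B ->
      P ((fun w => \sum_(i < m) \sum_(j < k) A i j * Y w i j) @^-1` B)
      = centered_normal v B.

Definition psd (k : nat) (S : 'M[R]_k) : Prop :=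
  S^T = S /\ forall v : 'cV[R]_k, 0 <= (v^T *m S *m v) 0 0.

Definition cvg_prob0 (dT : nat -> measure_display)
  (T : forall n, measurableType (dT n)) (P : forall n, probability (T n) R)
  (Z : forall n, T n -> R) : Prop :=
  forall e : R, 0 < e ->
    (fun n => P n [set w | e < `|Z n w|]) @ \oo --> 0%E.

End defs.

(* Main.v *)
Require Import Defs.
From HB Require Import structures.
From mathcomp Require Import all_boot all_order all_algebra.
From mathcomp Require Import all_classical all_reals all_analysis.
From mathcomp Require Import measurable_realfun ring lra.
Set Implicit Arguments. Unset Strict Implicit. Unset Printing Implicit Defensive.
Import Order.TTheory GRing.Theory Num.Theory.
Import numFieldNormedType.Exports.
Local Open Scope classical_set_scope.
Local Open Scope ring_scope.

(** Both directions rest on concentration: [psi n (Y n)] is close in L1 to its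
    mean for every pseudo-Lipschitz [psi n].  After clipping the entries to a
    box, [psi n] is replaced by its inf-convolution with a quadratic, which
    changes by O(1/n) when one row changes; the Efron-Stein inequality then
    bounds its variance by O(1/n).  The row-exchange symmetry of two independent
    copies of [Y n] that Efron-Stein needs is read off characteristic functions.

    A coupling transfers the concentration from [Y n] to [X n] because
    [frob (Y n) / sqrt n] is tight.  Conversely, applying (ii) to the distance
    to a set shows that two sets of non-negligible probability under [X n] and
    [Y n] are eventually close.  After quantizing space into finitely many
    cells, a maximal sub-coupling of the cell masses supported on close cells
    must then leave only a small mass unmatched. *)

(** Efron-Stein is too weak for [psi n] itself: on a box, replacing one row moves it by O(1/sqrt n),
    and n rows then give only a variance bound O(1). The squared norm in the inf-convolution is a
    sum over rows divided by [n], whence the O(1/n) change; the price L^2 / (4 lam) is made small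
    through [lam] before [n] is chosen. The threshold for [n] depends on [k], [C], [r] and the
    tolerance alone, because the function, the covariance and the probability space all vary with
    [n].

    [gaussian_mx] prescribes only the laws of linear functionals, so independence of the rows has to
    be extracted from integrals of cosines. Bernstein approximation carries these to bounded
    Lipschitz functions, and the same approximation makes such functions measurable for the
    sigma-algebra generated by the coordinates.

    In the converse, (ii) is applied at r = 1 to one sequence of distance functions per tolerance,
    and a diagonal choice then sends the tolerance to 0. *)

Section bounded_measurable.
Context (R : realType) (d : measure_display) (T : measurableType d)
  (P : probability T R).

(** No measure appears: such functions are integrable under every probability and stable under
    products, so integrability goals reduce to closure lemmas. *)
Definition bmeas (f : T -> R) :=
  measurable_fun setT f /\ exists M, forall x, `|f x| <= M.

Lemma bmeas_integrable f : bmeas f -> P.-integrable setT (EFin \o f).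
Proof.
move=> [mf [M bM]]; apply: measurable_bounded_integrable => //.
  exact: le_lt_trans (probability_le1 P measurableT) (ltry _).
exists M; split; first exact: num_real.
by move=> y My x _ /=; rewrite (le_trans (bM x))// ltW.
Qed.

Lemma bmeas_cst c : bmeas (fun=> c).
Proof. by split=> //; exists `|c|. Qed.

Lemma bmeasD f g : bmeas f -> bmeas g -> bmeas (fun x => f x + g x).
Proof.
move=> [mf [M bM]] [mg [N bN]]; split; first exact: measurable_funD.
by exists (M + N) => x; rewrite (le_trans (ler_normD _ _))// lerD.
Qed.

Lemma bmeasM f g : bmeas f -> bmeas g -> bmeas (fun x => f x * g x).
Proof.
move=> [mf [M bM]] [mg [N bN]]; split; first exact: measurable_funM.
by exists (M * N) => x; rewrite normrM ler_pM.
Qed.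

Lemma bmeasN f : bmeas f -> bmeas (fun x => - f x).
Proof.
move=> [mf [M bM]]; split; first exact: measurableT_comp.
by exists M => x; rewrite normrN.
Qed.

Lemma bmeasB f g : bmeas f -> bmeas g -> bmeas (fun x => f x - g x).
Proof. by move=> bf bg; apply: bmeasD => //; exact: bmeasN. Qed.

Lemma Rintegral_prob_cst c : \int[P]_x c = c.
Proof. by rewrite Rintegral_cst// [X in fine X]probability_setT mulr1. Qed.

Lemma le_Rintegral_norm (f g : T -> R) :
  P.-integrable setT (EFin \o f) -> P.-integrable setT (EFin \o g) ->
  (forall x, `|f x| <= g x) -> `|\int[P]_x f x| <= \int[P]_x g x.
Proof.
move=> fi gi fg; apply: le_trans (le_normr_Rintegral _ _) _ => //.
by apply: le_Rintegral => //; exact: integrable_norm.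
Qed.

End bounded_measurable.

(** * Bernstein approximation, uniform over Lipschitz functions *)

Section bernstein.
Context (R : realType).

(* The Bernstein operator, as the expectation of [g] at a binomial(m, u)
   variable, written recursively by conditioning on the first trial. *)
Fixpoint bernstein (m : nat) (g : nat -> R) (u : R) : R :=
  if m is m'.+1 then u * bernstein m' (g \o S) u + (1 - u) * bernstein m' g u
  else g 0%N.

Lemma bernstein_cst m c u : bernstein m (fun=> c) u = c.
Proof. by elim: m => //= m ->; rewrite -mulrDl; ring. Qed.

Lemma bernsteinB m f g u :
  bernstein m (fun l => f l - g l) u = bernstein m f u - bernstein m g u.
Proof.
elim: m f g => //= m IH f g.
by rewrite (IH (f \o S) (g \o S)) IH; ring.
Qed.

Lemma ler_bernstein m f g u : 0 <= u <= 1 -> (forall l, f l <= g l) ->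
  bernstein m f u <= bernstein m g u.
Proof.
move=> /andP[u0 u1]; elim: m f g => //= m IH f g fg.
by apply: lerD; apply: ler_wpM2l; rewrite ?subr_ge0//; apply: IH => l /=.
Qed.

Lemma ler_norm_bernstein m f u : 0 <= u <= 1 ->
  `|bernstein m f u| <= bernstein m (fun l => `|f l|) u.
Proof.
move=> u01; case/andP: (u01) => u0 u1; elim: m f => //= m IH f.
apply: le_trans (ler_normD _ _) _; rewrite !normrM ger0_norm//.
rewrite (@ger0_norm _ (1 - u)) ?subr_ge0//.
by apply: lerD; apply: ler_wpM2l; rewrite ?subr_ge0//; exact: IH.
Qed.

(** Binomial mean and variance in one formula: the second moment about [c] is the variance plus the
    squared bias. The induction generalizes [c], since a success in the first trial replaces it by
    [c - 1]. *)
Lemma bernstein_quadratic m a b c u :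
  bernstein m (fun l => a + b * (l%:R - c) ^+ 2) u =
  a + b * (m%:R * (u * (1 - u)) + (m%:R * u - c) ^+ 2).
Proof.
elim: m c => [|m IH] c /=; first by ring.
have -> : (fun l => a + b * (l%:R - c) ^+ 2) \o S =
    (fun l : nat => a + b * (l%:R - (c - 1)) ^+ 2).
  by apply/funext => l /=; rewrite -natr1; ring.
by rewrite !IH -natr1; ring.
Qed.

(** The degree is chosen before [G] and [u]. This uniformity is needed later, where [G] depends on
    the remaining coordinates of the point. *)
Lemma bernstein_cvg (K e : R) : 0 < e -> 0 <= K ->
  exists m, forall G : R -> R,
    (forall x y, `|G x - G y| <= K * `|x - y|) ->
    forall u : R, 0 <= u <= 1 ->
    `|bernstein m (fun l => G (l%:R / m%:R)) u - G u| <= e.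
Proof.
move=> e0 K0.
have [t t0 tE] : exists2 t : R, 0 < t & K * t <= e.
  exists (e / (K + 1)); first by rewrite divr_gt0// ltr_wpDl.
  by rewrite mulrA ler_pdivrMr ?ltr_wpDl// mulrC ler_pM2l// lerDl.
have [m m0 mt] : exists2 m : nat, 0 < m%:R :> R & t ^- 2 <= m%:R.
  exists (Num.truncn (t ^- 2)).+1; first by rewrite ltr0n.
  exact/ltW/truncnS_gt.
have m0' : m%:R != 0 :> R by rewrite gt_eqF.
have t0' : t != 0 by rewrite gt_eqF.
exists m => G GK u u01; have /andP[u0 u1] := u01.
have -> : G u = bernstein m (fun=> G u) u by rewrite bernstein_cst.
rewrite -bernsteinB; apply: le_trans (ler_norm_bernstein _ _ u01) _.
(* Quadratic majorant of K |l/m - u|, from |z| <= (t + z^2 / t) / 2; its Bernstein value is known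
   exactly and is at most K t by the choice of [m]. *)
pose q l := K * (t / 2) + K / (2 * t * m%:R ^+ 2) * (l%:R - m%:R * u) ^+ 2.
apply: (@le_trans _ _ (bernstein m q u)).
  apply: ler_bernstein => // l; apply: le_trans (GK _ _) _.
  have -> : q l = K * ((t + (l%:R / m%:R - u) ^+ 2 / t) / 2).
    by rewrite /q; field; rewrite t0'.
  apply: ler_wpM2l => //.
  set z := _ - u; rewrite -(real_normK (num_real z)).
  have : 0 <= (`|z| - t) ^+ 2 / t by rewrite divr_ge0 ?sqr_ge0// ltW.
  have -> : (`|z| - t) ^+ 2 / t = `|z| ^+ 2 / t + t - 2 * `|z|.
    by field.
  by lra.
rewrite bernstein_quadratic subrr expr0n/= addr0.
apply: le_trans tE.
have -> : K * (t / 2) + K / (2 * t * m%:R ^+ 2) * (m%:R * (u * (1 - u))) =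
    K * (t / 2 + (u * (1 - u)) * (t * (t ^- 2 / m%:R)) / 2).
  by field; rewrite m0'.
apply: ler_wpM2l => //.
have : (u * (1 - u)) * (t * (t ^- 2 / m%:R)) <= 1 * (t * 1).
  apply: ler_pM => //.
  - by rewrite mulr_ge0// subr_ge0.
  - by rewrite !mulr_ge0 ?invr_ge0 ?exprn_ge0 ?ltW.
  - nra.
  - by rewrite ler_pM2l// ler_pdivrMr// mul1r.
by lra.
Qed.

End bernstein.

Lemma bounded_cvg (R : realType) (d : measure_display) (T : measurableType d)
    (P : probability T R) (f_ : nat -> T -> R) (f : T -> R) (M : R) :
  (forall n, measurable_fun setT (f_ n)) -> (forall n x, `|f_ n x| <= M) ->
  (forall x, f_ ^~ x @ \oo --> f x) ->
  bmeas f /\ (fun n => \int[P]_x f_ n x) @ \oo --> \int[P]_x f x.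
Proof.
move=> mf_ bf_ cvf.
have mf : measurable_fun setT f.
  by apply: (measurable_fun_cvg (h := f_)) => // x _; exact: cvf.
have bf : bmeas f.
  split=> //; exists M => x.
  by apply: (cvgr_to_le (cvg_norm (cvf x))); exact: nearW.
split=> //.
have [||||| _ _ cv] := @dominated_convergence _ _ _ P setT measurableT
    (fun n x => (f_ n x)%:E) (fun x => (f x)%:E) (fun=> M%:E).
- by move=> n; apply/measurable_EFinP.
- by apply/measurable_EFinP.
- by apply: aeW => x _; apply/fine_cvgP; split; [near=> n | exact: cvf].
- exact: (bmeas_integrable P (@bmeas_cst _ _ T M)).
- by apply: aeW => x n _; rewrite /= lee_fin.
rewrite /Rintegral; apply: fine_cvg; rewrite fineK//.
by apply: (integrable_fin_num measurableT); exact: bmeas_integrable.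
Unshelve. all: by end_near. Qed.

Lemma sin_scale_cvg (R : realType) (x : R) :
  (fun n : nat => sin (n.+1%:R^-1 * x) / n.+1%:R^-1) @ \oo --> x.
Proof.
have [->|x0] := eqVneq x 0.
  under eq_fun do rewrite mulr0 sin0 mul0r; exact: cvg_cst.
have sin_div : (fun h : R => sin h / h) h @[h --> 0^'] --> (1 : R).
  have der := is_derive_sin (0 : R).
  have cv : cvg ((fun h : R => h^-1 *: ((sin \o shift 0) (h *: 1) - sin 0))
    @ (0 : R)^') := @ex_derive _ _ _ _ _ _ _ der.
  have := cvg_toP cv (@derive_val _ _ _ _ _ _ _ der); rewrite cos0.
  apply: cvg_trans; apply: near_eq_cvg; near=> h.
  by rewrite /= sin0 subr0 addr0 -[h *: 1]/(h * 1) mulr1 -[_ *: _]/(_ * _) mulrC.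
have h0 : (fun n : nat => n.+1%:R^-1 * x) @ \oo --> (0 : R)^'.
  have : (fun n : nat => n.+1%:R^-1 * x) @ \oo --> (0 : R).
    rewrite -(mul0r x); apply: cvgM; [exact: cvg_harmonic | exact: cvg_cst].
  move=> cv A /cv[N _ NA]; exists N => // n Nn; apply: (NA n Nn).
  by apply: mulf_neq0 => //; rewrite invr_eq0 pnatr_eq0.
have c1 : (fun n : nat => sin (n.+1%:R^-1 * x) / (n.+1%:R^-1 * x)) @ \oo
    --> (1 : R) := cvg_comp _ _ h0 sin_div.
have : (fun n : nat => sin (n.+1%:R^-1 * x) / (n.+1%:R^-1 * x) * x) @ \oo
    --> 1 * x by apply: cvgM => //; exact: cvg_cst.
rewrite mul1r; apply: cvg_trans; apply: near_eq_cvg; near=> n.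
by field; rewrite x0 nat1r pnatr_eq0.
Unshelve. all: by end_near. Qed.

(** * Equal characteristic functions give equal integrals of Lipschitz functions *)

Section cramer_wold.
Context (R : realType) (d : measure_display) (T : measurableType d)
  (P : probability T R) (I : finType) (W W' : T -> I -> R).

Let dot (a x : I -> R) : R := \sum_i a i * x i.

Hypothesis mW : forall i, measurable_fun setT (fun w => W w i).
Hypothesis mW' : forall i, measurable_fun setT (fun w => W' w i).
(** The free phase [c] lets cosines carry both the real and the imaginary part of the characteristic
    function. *)
Hypothesis chf : forall a c,
  \int[P]_w cos (dot a (W w) + c) = \int[P]_w cos (dot a (W' w) + c).

Let good (F : (I -> R) -> R) :=
  [/\ bmeas (F \o W), bmeas (F \o W') & \int[P]_w F (W w) = \int[P]_w F (W' w)].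

Let goodD F G : good F -> good G -> good (fun x => F x + G x).
Proof.
move=> [a b c] [a' b' c']; split; try exact: bmeasD.
by rewrite !RintegralD//; [rewrite c c' | exact: bmeas_integrable ..].
Qed.

Let good_cvg G_ F M : (forall n, good (G_ n)) -> (forall n x, `|G_ n x| <= M) ->
  (forall x, G_ ^~ x @ \oo --> F x) -> good F.
Proof.
move=> gG bG cG.
have [b cb] := @bounded_cvg _ _ _ P (fun n => G_ n \o W) (F \o W) M
  (fun n => let: And3 h _ _ := gG n in h.1) (fun n w => bG n (W w))
  (fun w => cG (W w)).
have [b' cb'] := @bounded_cvg _ _ _ P (fun n => G_ n \o W') (F \o W') M
  (fun n => let: And3 _ h _ := gG n in h.1) (fun n w => bG n (W' w))
  (fun w => cG (W' w)).
split => //.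
have E : (fun n => \int[P]_x (G_ n \o W) x) = (fun n => \int[P]_x (G_ n \o W') x).
  by apply/funext => n; case: (gG n).
move: cb; rewrite E => cb.
exact: (cvg_unique _ cb cb').
Qed.

(** Real trigonometric polynomials. With phases allowed, the product-to-sum formula makes them an
    algebra ([trigM]). *)
Inductive trig : ((I -> R) -> R) -> Prop :=
| trig_cos k a c : trig (fun x => k * cos (dot a x + c))
| trigD f g : trig f -> trig g -> trig (fun x => f x + g x).

Let measurable_dot (V : T -> I -> R) a :
  (forall i, measurable_fun setT (fun w => V w i)) ->
  measurable_fun setT (fun w => dot a (V w)).
Proof.
move=> mV; apply: measurable_sum => i.
exact: measurable_funM.
Qed.

Let trig_good t : trig t -> good t.
Proof.
elim=> [k a c|f g _ gf _ gg]; last exact: goodD.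
have bc V : (forall i, measurable_fun setT (fun w => V w i)) ->
    bmeas (fun w : T => cos (dot a (V w) + c)).
  move=> mV; split; last by exists 1 => w; exact: cos_max.
  apply: (measurableT_comp (f := cos)).
    by apply: continuous_measurable_fun; exact: continuous_cos.
  by apply: measurable_funD => //; exact: measurable_dot.
split.
- by apply: bmeasM; [exact: bmeas_cst | exact: bc].
- by apply: bmeasM; [exact: bmeas_cst | exact: bc].
rewrite !RintegralZl//; [by rewrite chf | exact: bmeas_integrable (bc _ _)..].
Qed.

Let trig_bounded t : trig t -> exists M, forall x, `|t x| <= M.
Proof.
elim=> [k a c|f g _ [M bM] _ [N bN]].
  by exists `|k| => x; rewrite normrM ler_piMr// cos_max.
by exists (M + N) => x; rewrite (le_trans (ler_normD _ _))// lerD.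
Qed.

Let dot0 x : dot (fun=> 0) x = 0.
Proof. by rewrite /dot big1// => i _; rewrite mul0r. Qed.

Let trig_cst c : trig (fun=> c).
Proof.
have := trig_cos c (fun=> 0) 0; congr trig; apply/funext => x.
by rewrite dot0 addr0 cos0 mulr1.
Qed.

Let trigM f g : trig f -> trig g -> trig (fun x => f x * g x).
Proof.
move=> tf tg; elim: tf => [k a c|f1 f2 _ t1 _ t2]; last first.
  have := trigD t1 t2; congr trig; apply/funext => x; exact/esym/mulrDl.
elim: tg => [k' a' c'|f1 f2 _ t1 _ t2]; last first.
  have := trigD t1 t2; congr trig; apply/funext => x; exact/esym/mulrDr.
have := trigD
  (trig_cos (k * k' / 2) (fun i => a i + a' i) (c + c'))
  (trig_cos (k * k' / 2) (fun i => a i - a' i) (c - c')).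
congr trig; apply/funext => x.
have -> : dot (fun i => a i + a' i) x + (c + c') =
    (dot a x + c) + (dot a' x + c').
  by rewrite addrACA; congr (_ + _); rewrite /dot -big_split/=;
     apply: eq_bigr => i _; rewrite mulrDl.
have -> : dot (fun i => a i - a' i) x + (c - c') =
    (dot a x + c) - (dot a' x + c').
  rewrite opprD addrACA; congr (_ + _); rewrite /dot -sumrB.
  by apply: eq_bigr => i _; rewrite mulrBl.
by rewrite cosD cosB; field.
Qed.

(** Each level of the Bernstein recursion multiplies the prefactor by [u] or [1 - u], again
    trigonometric. This is why [t] is quantified inside the induction. *)
Let good_bernstein (u : (I -> R) -> R) (F_ : nat -> (I -> R) -> R) m :
  trig u -> (forall l t, trig t -> good (fun x => t x * F_ l x)) ->
  forall t, trig t -> good (fun x => t x * bernstein m (F_^~ x) (u x)).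
Proof.
move=> tu; elim: m F_ => [|m IH] F_ gF t tt /=; first exact: gF.
have g1 := IH (fun l => F_ l.+1) (fun l => gF l.+1) _ (trigM tt tu).
have t1u : trig (fun x => 1 - u x).
  have := trigD (trig_cst 1) (trigM (trig_cst (-1)) tu).
  by congr trig; apply/funext => x; rewrite mulN1r.
have g2 := IH F_ gF _ (trigM tt t1u).
have := goodD g1 g2; congr good; apply/funext => x.
exact: esym (etrans (mulrDr _ _ _) (congr2 +%R (mulrA _ _ _) (mulrA _ _ _))).
Qed.

Let upd (x : I -> R) i v := fun j => if j == i then v else x j.

Let lip K (F : (I -> R) -> R) :=
  forall x y, `|F x - F y| <= K * \sum_i `|x i - y i|.

(** Induction on a list [J] of coordinates that determine [F]. In coordinate [i], [F] is replaced by
    its Bernstein polynomial in [u = (1 + sin (s x_i)) / 2]; at each node that coordinate is frozen,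
    so only [J] remains, and the powers of [u] are absorbed by the prefactor [t]. *)
Let good_sin (s K : R) : 0 < s -> 0 <= K -> forall (J : seq I) F M,
  lip K F -> (forall x, `|F x| <= M) ->
  (forall x y, {in J, x =1 y} -> F x = F y) ->
  forall t, trig t -> good (fun x => t x * F (fun i => sin (s * x i) / s)).
Proof.
move=> s0 K0; elim=> [|i J IH] F M lF bF FJ t tt.
  (* With no coordinate left, [F] is constant. *)
  have := trig_good (trigM tt (trig_cst (F (fun=> 0)))).
  by congr good; apply/funext => x; congr (_ * _); exact: FJ.
pose S (x : I -> R) i := sin (s * x i) / s.
pose u x := (1 + sin (s * x i)) / 2.
have u01 x : 0 <= u x <= 1.
  have := sin_max (s * x i); rewrite ler_norml /u => /andP[? ?].
  by apply/andP; split; lra.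
have tu : trig u.
  pose a j := if j == i then s else 0.
  have := trigD (trig_cst 2^-1) (trig_cos 2^-1 a (- (pi / 2))).
  congr trig; apply/funext => x; rewrite /u.
  have -> : dot a x = s * x i.
    rewrite /dot (bigD1 i)//= /a eqxx big1 ?addr0// => j /negbTE ->.
    by rewrite mul0r.
  by rewrite cosBpihalf; ring.
pose pt (v : R) := (2 * v - 1) / s.
have ptS x : pt (u x) = S x i by rewrite /pt /u /S; congr (_ / _); field.
have [Mt bt] := trig_bounded tt.
have Mt0 : 0 <= Mt by apply: le_trans (bt (fun=> 0)).
have updS x : upd (S x) i (pt (u x)) = S x.
  by apply/funext => j; rewrite /upd ptS; case: eqP => // ->.
have lipu x : forall v w, `|F (upd x i (pt v)) - F (upd x i (pt w))| <=
    (K * (2 / s)) * `|v - w|.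
  move=> v w; apply: le_trans (lF _ _) _; rewrite -mulrA; apply: ler_wpM2l => //.
  rewrite (bigD1 i)//= big1 ?addr0; last first.
    by move=> j /negbTE ji; rewrite /upd ji subrr normr0.
  rewrite /upd eqxx /pt.
  have -> : (2 * v - 1) / s - (2 * w - 1) / s = 2 / s * (v - w).
    by field; rewrite gt_eqF.
  by rewrite normrM ger0_norm// divr_ge0// ltW.
have K'0 : 0 <= K * (2 / s) by rewrite mulr_ge0// divr_ge0// ltW.
(* The Lipschitz constant in coordinate [i] does not depend on the others, so one degree serves all
   [x]. *)
have /choice[m mP] : forall n : nat, exists m : nat, forall x,
    `|bernstein m (fun l => F (upd (S x) i (pt (l%:R / m%:R)))) (u x) - F (S x)|
      <= n.+1%:R^-1.
  move=> n; have n0 : 0 < n.+1%:R^-1 :> R by rewrite invr_gt0 ltr0n.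
  have [m mP] := bernstein_cvg n0 K'0.
  exists m => x; rewrite -[in F (S x)]updS.
  exact: (mP (fun v => F (upd (S x) i (pt v))) (lipu (S x)) (u x) (u01 x)).
pose G_ n x := t x *
  bernstein (m n) (fun l => F (upd (S x) i (pt (l%:R / (m n)%:R)))) (u x).
apply: (@good_cvg G_ _ (Mt * (M + 1))).
- move=> n; apply: (@good_bernstein u
    (fun l x => F (upd (S x) i (pt (l%:R / (m n)%:R))))) => // l t' tt'.
  apply: (IH (fun y => F (upd y i (pt (l%:R / (m n)%:R)))) M) => //.
  + move=> x y; apply: le_trans (lF _ _) _; apply: ler_wpM2l => //.
    by apply: ler_sum => j _; rewrite /upd; case: eqP => // _; rewrite subrr normr0.
  + move=> x y xy; apply: FJ => j; rewrite inE /upd.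
    by case: eqP => //= _; exact: xy.
- move=> n x; rewrite /G_ normrM; apply: ler_pM => //.
  rewrite -[X in `|X|](subrK (F (S x))) (le_trans (ler_normD _ _))// addrC lerD//.
  by apply: le_trans (mP n x) _; rewrite invf_le1// ler1n.
move=> x; apply: cvgM; first exact: cvg_cst.
apply/cvgrPdist_le => e e0; near=> n.
rewrite distrC; apply: le_trans (mP n x) _; near: n.
have /cvgrPdist_le/(_ e e0) := @cvg_harmonic R.
by apply: filterS => n; rewrite sub0r normrN ger0_norm// ltW// harmonic_gt0.
Unshelve. all: by end_near. Qed.

(* Bounded Lipschitz functions of [x] are limits of functions of
   [sin (s x) / s] as [s -> 0], and Bernstein polynomials in the bounded
   variables [sin (s x_i)] are trigonometric polynomials. *)
Lemma cramer_wold (K M : R) (F : (I -> R) -> R) : 0 <= K ->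
  (forall x y, `|F x - F y| <= K * \sum_i `|x i - y i|) ->
  (forall x, `|F x| <= M) ->
  bmeas (F \o W) /\ \int[P]_w F (W w) = \int[P]_w F (W' w).
Proof.
move=> K0 lF bF; suff : good F by case.
apply: (@good_cvg (fun n x => F (fun i => sin (n.+1%:R^-1 * x i) / n.+1%:R^-1))
  _ M) => //.
  move=> n; have n0 : 0 < n.+1%:R^-1 :> R by rewrite invr_gt0 ltr0n.
  have /(_ (enum I) F M lF bF) := good_sin n0 K0.
  move=> /(_ _ _ (trig_cst 1)).
  have -> : (fun x => 1 * F (fun i => sin (n.+1%:R^-1 * x i) / n.+1%:R^-1)) =
    (fun x => F (fun i => sin (n.+1%:R^-1 * x i) / n.+1%:R^-1)).
    by apply/funext => x; rewrite mul1r.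
  apply=> x y xy; congr F; apply/funext => i; apply: xy; exact: mem_enum.
move=> x; apply/cvgrPdist_le => e e0.
pose S n i := sin (n.+1%:R^-1 * x i) / n.+1%:R^-1.
have : (fun n => K * \sum_i `|x i - S n i|) @ \oo --> K * \sum_(i : I) 0.
  apply: cvgM; first exact: cvg_cst.
  apply: cvg_big => [|i _]; first exact: add_continuous.
  suff : (fun n => `|x i - S n i|) @ \oo --> `|x i - x i|.
    by rewrite subrr normr0.
  by apply: cvg_norm; apply: cvgB; [exact: cvg_cst | exact: sin_scale_cvg].
rewrite big1// mulr0 => /cvgrPdist_le/(_ e e0); apply: filterS => n.
rewrite sub0r normrN => h; apply: le_trans (lF _ _) _.
by apply: le_trans h; exact: ler_norm.
Qed.

End cramer_wold.

(** Taking [W' = W] makes the hypothesis on cosines trivial. What remains is measurability: a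
    bounded Lipschitz function is a limit of trigonometric polynomials in the coordinates. *)
Lemma bmeas_lipschitz (R : realType) (d : measure_display) (T : measurableType d)
    (P : probability T R) (I : finType) (W : T -> I -> R) (K M : R)
    (F : (I -> R) -> R) :
  (forall i, measurable_fun setT (fun w => W w i)) -> 0 <= K ->
  (forall x y, `|F x - F y| <= K * \sum_i `|x i - y i|) ->
  (forall x, `|F x| <= M) -> bmeas (F \o W).
Proof.
by move=> mW K0 lF bF; case: (@cramer_wold _ _ _ P _ W W mW mW (fun _ _ => erefl)
  _ _ _ K0 lF bF).
Qed.

(** * One-dimensional normal integrals *)

Section normal_facts.
Context (R : realType).
Notation mu := (@lebesgue_measure R).
Implicit Types (m s x y t : R).

Lemma ge0_integral_normal_prob m s (f : R -> \bar R) :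
  measurable_fun setT f -> (forall x, 0 <= f x)%E ->
  (\int[normal_prob m s]_x f x = \int[mu]_x (f x * (normal_pdf m s x)%:E))%E.
Proof.
move=> mf f0; have dom := @normal_prob_dominates R m s.
rewrite -(Radon_Nikodym_SigmaFinite.change_of_variables dom)//.
have gi := Radon_Nikodym_SigmaFinite.f_integrable dom.
have mpdf : measurable_fun [set: R] (fun x => (normal_pdf m s x)%:E).
  by apply/measurable_EFinP; exact: measurable_normal_pdf.
apply: ae_eq_integral => //.
- by apply: emeasurable_funM => //; exact: measurable_int gi.
- exact: emeasurable_funM.
- apply: ae_eqe_mul2l; apply: integral_ae_eq => // E _ mE.
  by rewrite -Radon_Nikodym_SigmaFinite.f_integral.
Qed.

Lemma ge0_integral_opp (f : R -> \bar R) :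
  measurable_fun setT f -> (forall x, 0 <= f x)%E ->
  (\int[mu]_x f x = \int[mu]_x f (- x)%R)%E.
Proof.
move=> mf f0.
transitivity (\int[pushforward mu (-%R : _ -> measurableTypeR R)]_x f x)%E.
  by apply: eq_measure_integral => B mB _; exact/esym/lebesgue_measureN.
by rewrite ge0_integral_pushforward// preimage_setT.
Qed.

Lemma integral_normal_prob_expR s t : s != 0 ->
  (\int[normal_prob 0 s]_x (expR (t * x))%:E =
   (expR (t ^+ 2 * s ^+ 2 / 2))%:E)%E.
Proof.
move=> s0; rewrite ge0_integral_normal_prob; last 2 first.
- apply/measurable_EFinP; apply: (measurableT_comp (f := expR)); first exact: measurable_expR.
  exact: mulrl_measurable.
- by move=> x; rewrite lee_fin expR_ge0.
(* Completing the square: the exponential tilt moves the mean to t s^2. *)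
transitivity (\int[mu]_x ((expR (t ^+ 2 * s ^+ 2 / 2))%:E *
    (normal_pdf (t * s ^+ 2) s x)%:E))%E.
  apply: eq_integral => x _; rewrite -!EFinM; congr EFin.
  rewrite !normal_pdfE// mulrCA [RHS]mulrCA; congr (_ * _).
  rewrite /normal_fun -!expRD; congr expR; field; exact: s0.
rewrite ge0_integralZl//; last 2 first.
- by apply/measurable_EFinP; exact: measurable_normal_pdf.
- by move=> x _; rewrite lee_fin normal_pdf_ge0.
by rewrite integral_normal_pdf mule1.
Qed.

Lemma bmeas_cos (a : R) : bmeas (fun x : measurableTypeR R => cos (x + a)).
Proof.
split; last by exists 1 => x; exact: cos_max.
apply: (measurableT_comp (f := cos)).
  by apply: continuous_measurable_fun; exact: continuous_cos.
exact: measurable_funD.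
Qed.

Lemma bmeas_sin : bmeas (@sin R : measurableTypeR R -> R).
Proof.
split; last by exists 1 => x; exact: sin_max.
by apply: continuous_measurable_fun; exact: continuous_sin.
Qed.

Let ge0_Rintegral (P : probability (measurableTypeR R) R) f : bmeas f ->
  (\int[P]_x (f x)%:E = (\int[P]_x f x)%:E)%E.
Proof.
move=> bf; rewrite /Rintegral fineK//.
by apply: (integrable_fin_num measurableT); exact: bmeas_integrable.
Qed.

(** Reflection exchanges 1 + sin and 1 - sin. Adding 1 makes both nonnegative, so the reflection can
    be done on extended integrals. *)
Lemma integral_normal_prob_sin s : s != 0 -> \int[normal_prob 0 s]_x sin x = 0.
Proof.
move=> s0.
have b1 : bmeas (fun x : measurableTypeR R => 1 + sin x).
  by apply: bmeasD; [exact: bmeas_cst | exact: bmeas_sin].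
have b2 : bmeas (fun x : measurableTypeR R => 1 - sin x).
  by apply: bmeasB; [exact: bmeas_cst | exact: bmeas_sin].
have p1 x : (0 <= (1 + sin x)%:E)%E.
  by rewrite lee_fin; have := sin_max x; rewrite ler_norml => /andP[]; lra.
have p2 x : (0 <= (1 - sin x)%:E)%E.
  by rewrite lee_fin; have := sin_max x; rewrite ler_norml => /andP[]; lra.
have E : (\int[normal_prob 0 s]_x (1 + sin x)%:E =
          \int[normal_prob 0 s]_x (1 - sin x)%:E)%E.
  rewrite !ge0_integral_normal_prob//; last 2 first.
    by apply/measurable_EFinP; case: b2.
    by apply/measurable_EFinP; case: b1.
  rewrite ge0_integral_opp; last 2 first.
  - apply: emeasurable_funM; first by apply/measurable_EFinP; case: b1.
    by apply/measurable_EFinP; exact: measurable_normal_pdf.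
  - by move=> x; rewrite mule_ge0// lee_fin normal_pdf_ge0.
  apply: eq_integral => x _ /=; rewrite sinN; congr (_ * _%:E)%E.
  by rewrite !normal_pdfE// /normal_fun !subr0 sqrrN.
move: E; rewrite !ge0_Rintegral// => -[].
rewrite RintegralD//; try exact: (bmeas_integrable _ (bmeas_cst _ _)).
  rewrite RintegralB//; try exact: (bmeas_integrable _ (bmeas_cst _ _)).
    by lra.
  exact: (bmeas_integrable _ bmeas_sin).
exact: (bmeas_integrable _ bmeas_sin).
Qed.

(** The characteristic function at frequency 1, as a function of the standard deviation; it enters
    the argument through the product rule [normal_chfM]. *)
Definition normal_chf s : R := \int[normal_prob 0 s]_x cos x.

Lemma integral_normal_prob_cosD s a : s != 0 ->
  \int[normal_prob 0 s]_x cos (x + a) = cos a * normal_chf s.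
Proof.
move=> s0; have bc : bmeas (@cos R : measurableTypeR R -> R).
  by have := bmeas_cos 0; under eq_fun do rewrite addr0.
under eq_Rintegral do rewrite cosD.
rewrite RintegralB//; last 2 first.
- by apply: bmeas_integrable; apply: bmeasM => //; exact: bmeas_cst.
- by apply: bmeas_integrable; apply: bmeasM; [exact: bmeas_sin|exact: bmeas_cst].
rewrite !RintegralZr//; last 2 first.
- exact: (bmeas_integrable _ bmeas_sin).
- exact: (bmeas_integrable _ bc).
by rewrite integral_normal_prob_sin// mul0r subr0 mulrC.
Qed.

(** Cosines are raised by 1 throughout, so that substitution and Tonelli apply to nonnegative
    integrands. *)
Let cos1_ge0 a x : (0 <= (1 + cos (x + a))%:E)%E.
Proof.
by rewrite lee_fin; have := cos_max (x + a); rewrite ler_norml => /andP[]; lra.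
Qed.

Let bmeas_cos1 a : bmeas (fun x : measurableTypeR R => 1 + cos (x + a)).
Proof. by apply: bmeasD; [exact: bmeas_cst | exact: bmeas_cos]. Qed.

Let ge0_integral_cos1 s a : s != 0 ->
  (\int[normal_prob 0 s]_x (1 + cos (x + a))%:E =
  (1 + cos a * normal_chf s)%:E)%E.
Proof.
move=> s0; rewrite ge0_Rintegral// RintegralD//; last 2 first.
- exact: (bmeas_integrable _ (bmeas_cst _ _)).
- exact: (bmeas_integrable _ (bmeas_cos a)).
by rewrite Rintegral_prob_cst integral_normal_prob_cosD.
Qed.

Lemma integral_normal_prob_shift m s : s != 0 ->
  (\int[mu]_x ((1 + cos x)%:E * (normal_pdf m s x)%:E) =
  (1 + cos m * normal_chf s)%:E)%E.
Proof.
move=> s0; rewrite -ge0_integral_cos1// ge0_integral_normal_prob//; last first.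
  by apply/measurable_EFinP; case: (bmeas_cos1 m).
under eq_integral do rewrite -EFinM.
pose F (x : R^o) : R^o := x + m.
have F'E : F^`()%classic = cst 1.
  by apply/funext => x; rewrite /F derive1E deriveD// derive_cst derive_id addr0.
rewrite (@increasing_ge0_integration_by_substitutionT _ F).
- apply: eq_integral => x _; rewrite F'E !fctE /= mulr1 EFinM.
  congr (_ * _%:E)%E; rewrite !normal_pdfE// /normal_fun /F.
  by rewrite addrK subr0.
- by move=> x y xy; rewrite /F ltrD2r.
- by rewrite F'E => ?; exact: cvg_cst.
- by rewrite F'E; exact: is_cvg_cst.
- by rewrite F'E; exact: is_cvg_cst.
- by move=> x; exact: derivableD.
- exact: cvg_addrr_Ny.
- exact: cvg_addrr.
- move=> x; apply: cvgM; last exact: continuous_normal_pdf.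
  by apply: cvgD; [exact: cvg_cst | exact: continuous_cos].
- move=> x; rewrite mulr_ge0 ?normal_pdf_ge0//.
Qed.

(** Bayes' rule for [y] of law N(0, w^2) and [x] given [y] of law N(y, s^2): the joint density is
    also the marginal of [x] times the conditional density of [y]. *)
Lemma normal_pdf_convolution s w x y : s != 0 -> w != 0 ->
  let u := Num.sqrt (s ^+ 2 + w ^+ 2) in
  normal_pdf y s x * normal_pdf 0 w y =
  normal_pdf 0 u x * normal_pdf (x * w ^+ 2 / u ^+ 2) (s * w / u) y.
Proof.
move=> s0 w0 u.
have s2 : 0 < s ^+ 2 by rewrite exprn_even_gt0.
have w2 : 0 < w ^+ 2 by rewrite exprn_even_gt0.
have u2 : u ^+ 2 = s ^+ 2 + w ^+ 2 by rewrite sqr_sqrtr// addr_ge0// ltW.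
have sw : s ^+ 2 + w ^+ 2 != 0 by rewrite gt_eqF// addr_gt0.
have u0 : u != 0 by apply: contraNneq sw => u0; rewrite -u2 u0 expr0n.
have su : s * w / u != 0 by rewrite !mulf_neq0// invr_eq0.
rewrite !normal_pdfE// /normal_peak /normal_fun.
rewrite mulrACA [RHS]mulrACA -!expRD -!invfM; congr (_^-1 * expR _).
  rewrite -!sqrtrM; last 2 first.
  - by rewrite mulrn_wge0// mulr_ge0 ?sqr_ge0 ?pi_ge0.
  - by rewrite mulrn_wge0// mulr_ge0 ?sqr_ge0 ?pi_ge0.
  congr Num.sqrt; field; exact: u0.
rewrite !exprMn exprVn u2; field.
by rewrite sw w0 s0.
Qed.

(** The function 1 + cos x is integrated against this joint density in both orders: [x] first yields
    the product, [y] first leaves the normal law of standard deviation [u]. *)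
Lemma normal_chfM s w : s != 0 -> w != 0 ->
  normal_chf s * normal_chf w = normal_chf (Num.sqrt (s ^+ 2 + w ^+ 2)).
Proof.
move=> s0 w0; set u := Num.sqrt _.
have u0 : u != 0.
  by rewrite gt_eqF// sqrtr_gt0 addr_gt0// exprn_even_gt0.
have bs : bmeas (fun y : measurableTypeR R => 1 + cos y * normal_chf s).
  apply: bmeasD; [exact: bmeas_cst | apply: bmeasM; last exact: bmeas_cst].
  by have := bmeas_cos 0; under eq_fun do rewrite addr0.
have chf1 : `|normal_chf s| <= 1.
  rewrite -[leRHS](Rintegral_prob_cst (normal_prob 0 s)).
  apply: le_Rintegral_norm; last by move=> x; exact: cos_max.
  - apply: bmeas_integrable.
    by have := bmeas_cos 0; under eq_fun do rewrite addr0.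
  - exact: (bmeas_integrable _ (bmeas_cst _ _)).
have ps y : (0 <= (1 + cos y * normal_chf s)%:E)%E.
  rewrite lee_fin -lerBlDl sub0r lerNl.
  apply: le_trans (ler_norm _) _; rewrite normrN normrM mulr_ile1//.
  exact: cos_max.
have Z c : \int[normal_prob 0 w]_y (cos y * c) = normal_chf w * c.
  apply: RintegralZr; first exact: measurableT.
  apply: bmeas_integrable.
  by have := bmeas_cos 0; under eq_fun do rewrite addr0.
have L : (\int[normal_prob 0 w]_y (1 + cos y * normal_chf s)%:E =
    (1 + normal_chf s * normal_chf w)%:E)%E.
  rewrite ge0_Rintegral// RintegralD//; last 2 first.
  - exact: (bmeas_integrable _ (bmeas_cst _ _)).
  - apply: bmeas_integrable; apply: bmeasM; last exact: bmeas_cst.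
    by have := bmeas_cos 0; under eq_fun do rewrite addr0.
  exact: (congr1 EFin (congr2 +%R (Rintegral_prob_cst _ 1)
    (etrans (Z _) (mulrC _ _)))).
suff : ((1 + normal_chf s * normal_chf w)%:E = (1 + normal_chf u)%:E)%E.
  by move=> -[] /addrI.
have M : (\int[normal_prob 0 u]_y (1 + cos y)%:E = (1 + normal_chf u)%:E)%E.
  have := ge0_integral_cos1 0 u0; rewrite cos0 mul1r.
  by under eq_integral do rewrite addr0.
have mc : measurable_fun setT (fun x : R => (1 + cos x)%:E).
  apply/measurable_EFinP; have [] := bmeas_cos1 0.
  by under eq_fun do rewrite addr0.
have c0 x : (0 <= (1 + cos x)%:E)%E by have := cos1_ge0 0 x; rewrite addr0.
have ms : measurable_fun setT (fun x : R => (1 + cos x * normal_chf s)%:E).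
  by apply/measurable_EFinP; case: bs.
rewrite -L -M (ge0_integral_normal_prob _ _ ms ps)
  (ge0_integral_normal_prob _ _ mc c0).
pose h (z : R * R) := ((1 + cos z.2)%:E *
  ((normal_pdf z.1 s z.2)%:E * (normal_pdf 0 w z.1)%:E))%E.
have hE x y : h (y, x) = ((1 + cos x)%:E * ((normal_pdf 0 u x)%:E *
    (normal_pdf (x * w ^+ 2 / u ^+ 2) (s * w / u) y)%:E))%E.
  by rewrite /h /= -!EFinM normal_pdf_convolution.
have mh : measurable_fun setT h.
  apply: emeasurable_funM; [|apply: emeasurable_funM]; apply/measurable_EFinP.
  - apply: measurable_funD => //; apply: (measurableT_comp (f := cos)) => //.
    by apply: continuous_measurable_fun; exact: continuous_cos.
  - under eq_fun do rewrite normal_pdfE//.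
    apply: measurable_funM => //; apply: (measurableT_comp (f := expR)); first exact: measurable_expR.
    apply: measurable_funM => //=; apply: measurableT_comp => //=.
    by apply: measurable_funX => //=; exact: measurable_funB.
  - by apply: (measurableT_comp (measurable_normal_pdf _ _)).
have h0 z : (0 <= h z)%E.
  by rewrite /h !mule_ge0// lee_fin normal_pdf_ge0.
transitivity (\int[mu]_y \int[mu]_x h (y, x))%E.
  apply: eq_integral => y _; rewrite -integral_normal_prob_shift// -ge0_integralZr//.
  - by apply: eq_integral => x _; rewrite /h /= muleA.
  - apply: emeasurable_funM => //; apply/measurable_EFinP.
    exact: measurable_normal_pdf.
  - by move=> x _; rewrite mule_ge0// lee_fin normal_pdf_ge0.
  - by rewrite lee_fin normal_pdf_ge0.
rewrite (@fubini_tonelli _ _ _ _ _ mu mu h)//.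
apply: eq_integral => x _; under eq_integral do rewrite hE muleA.
rewrite ge0_integralZl//; last 3 first.
- by apply/measurable_EFinP; exact: measurable_normal_pdf.
- by move=> y _; rewrite lee_fin normal_pdf_ge0.
- by rewrite mule_ge0// lee_fin normal_pdf_ge0.
by rewrite integral_normal_pdf mule1.
Qed.

End normal_facts.

Lemma Rintegral_prod (R : realType) (d1 d2 : measure_display)
    (T1 : measurableType d1) (T2 : measurableType d2)
    (P1 : probability T1 R) (P2 : probability T2 R) f g :
  bmeas f -> bmeas g ->
  \int[(P1 \x P2)%E]_w (f w.1 * g w.2) = \int[P1]_x f x * \int[P2]_y g y.
Proof.
move=> bf bg.
have bf1 : bmeas (fun w : T1 * T2 => f w.1).
  case: bf => mf [M bM]; split; last by exists M.
  exact: (measurableT_comp mf measurable_fst).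
have bg2 : bmeas (fun w : T1 * T2 => g w.2).
  case: bg => mg [M bM]; split; last by exists M.
  exact: (measurableT_comp mg measurable_snd).
have ifg : (P1 \x P2)%E.-integrable setT (EFin \o (fun w => f w.1 * g w.2)).
  exact/bmeas_integrable/bmeasM.
rewrite {1}/Rintegral -(integral12_prod_meas1 ifg) /=.
rewrite -RintegralZr//; last exact: bmeas_integrable.
congr fine; apply: eq_integral => x _; rewrite /fubini_F /=.
under eq_integral do rewrite EFinM.
rewrite integralZl//; last exact: (bmeas_integrable P2 bg).
rewrite EFinM; congr (_ * _)%E; rewrite /Rintegral fineK//.
by apply: (integrable_fin_num measurableT); exact: bmeas_integrable.
Qed.

(** * Integrals and moments of a variable with centered normal law *)

Section centered_normal_law.
Context (R : realType) (d : measure_display) (T : measurableType d)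
  (P : probability T R) (L : T -> R) (v : R).
Hypothesis mL : measurable_fun setT L.
Hypothesis v0 : 0 <= v.
Hypothesis lawL : forall B : set R, measurable B ->
  P (L @^-1` B) = centered_normal v B.

Lemma Rintegral_law (g : measurableTypeR R -> R) : bmeas g ->
  \int[P]_w g (L w) =
  if v == 0 then g 0 else \int[normal_prob 0 (Num.sqrt v)]_x g x.
Proof.
move=> bg; have mg := bg.1.
pose L' : {mfun T >-> measurableTypeR R} :=
  HB.pack (L : T -> measurableTypeR R) (isMeasurableFun.Build _ _ T (measurableTypeR R) _ mL).
have iL : P.-integrable setT ((EFin \o g) \o L').
  apply: bmeas_integrable; case: bg => _ [M bM].
  by split; [exact: measurableT_comp | exists M => x; exact: bM].
have mEg : measurable_fun setT (EFin \o g) by apply/measurable_EFinP.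
have := integral_distribution mEg iL.
rewrite /Rintegral /= => <-.
case: ifPn => v0'.
  rewrite (eq_measure_integral (\d_(0 : measurableTypeR R))); last first.
    by move=> B mB _; rewrite [LHS](lawL mB) /centered_normal v0'.
  by rewrite integral_dirac// diracT mul1e.
rewrite [X in fine X = _](eq_measure_integral (normal_prob 0 (Num.sqrt v)))//.
move=> B mB _; by rewrite [LHS](lawL mB) /centered_normal (negbTE v0').
Qed.

Lemma ge0_integral_law_expR t :
  (\int[P]_w (expR (t * L w))%:E = (expR (t ^+ 2 * v / 2))%:E)%E.
Proof.
pose g (x : measurableTypeR R) := (expR (t * x))%:E.
pose L' : {mfun T >-> measurableTypeR R} :=
  HB.pack (L : T -> measurableTypeR R) (isMeasurableFun.Build _ _ T (measurableTypeR R) _ mL).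
have mg : measurable_fun setT g.
  apply/measurable_EFinP; apply: (measurableT_comp (f := expR)).
    exact: measurable_expR.
  exact: mulrl_measurable.
have g0 x : (0 <= g x)%E by rewrite lee_fin expR_ge0.
rewrite -[LHS](ge0_integral_distribution L' mg g0).
have [v00|v0'] := eqVneq v 0.
  rewrite (eq_measure_integral (\d_(0 : measurableTypeR R))); last first.
    by move=> B mB _; rewrite [LHS](lawL mB) /centered_normal v00 eqxx.
  by rewrite integral_dirac// diracT mul1e /g v00 !mulr0 mul0r.
rewrite (eq_measure_integral (normal_prob 0 (Num.sqrt v))); last first.
  by move=> B mB _; rewrite [LHS](lawL mB) /centered_normal (negbTE v0').
rewrite integral_normal_prob_expR ?sqr_sqrtr//.
by rewrite gt_eqF// sqrtr_gt0 lt_def v0' v0.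
Qed.

End centered_normal_law.

(** The inequality y <= exp y at y = |x| / m, raised to the power [m]; this is the origin of m^m in
    [moment_bound]. *)
Lemma normr_exp_le_expR (R : realType) (m : nat) (x : R) : (0 < m)%N ->
  `|x| ^+ m <= m%:R ^+ m * (expR x + expR (- x)).
Proof.
move=> m0; have m0' : 0 < m%:R :> R by rewrite ltr0n.
apply: (@le_trans _ _ (m%:R ^+ m * expR `|x|)); last first.
  apply: ler_wpM2l; first by rewrite exprn_ge0.
  case: (ger0P x) => _; first by rewrite lerDl expR_ge0.
  by rewrite lerDr expR_ge0.
have -> : `|x| = m%:R * (`|x| / m%:R) by rewrite mulrCA divff ?mulr1// gt_eqF.
rewrite expRM_natl exprMn ler_pM2l ?exprn_gt0//.
rewrite ler_pXn2r ?nnegrE ?expR_ge0 ?divr_ge0//.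
by apply: le_trans (expR_ge1Dx _); rewrite lerDr.
Qed.

(** Exponential moments at 1 and -1 dominate every power. The bound involves the variance only
    through [C], hence is uniform over the sequence. *)
Lemma law_moment_le (R : realType) (d : measure_display) (T : measurableType d)
    (P : probability T R) (L : T -> R) (v C : R) (m : nat) :
  measurable_fun setT L -> 0 <= v <= C -> (0 < m)%N ->
  (forall B : set R, measurable B -> P (L @^-1` B) = centered_normal v B) ->
  (\int[P]_w (`|L w| ^+ m)%:E <= (m%:R ^+ m * (2 * expR (C / 2)))%:E)%E.
Proof.
move=> mL /andP[v0 vC] m0 lawL.
have mexp t : measurable_fun setT (fun w => (expR (t * L w))%:E).
  apply/measurable_EFinP; apply: (measurableT_comp (f := expR)).
    exact: measurable_expR.
  exact: measurable_funM.
apply: (@le_trans _ _ (\int[P]_w ((m%:R ^+ m)%:E *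
    ((expR (1 * L w))%:E + (expR ((-1) * L w))%:E)))%E).
  apply: ge0_le_integral; first exact: measurableT.
  - by move=> w _; rewrite lee_fin exprn_ge0.
  - apply/measurable_EFinP/measurable_funX.
    exact: measurableT_comp.
  - by apply: emeasurable_funM => //; exact: emeasurable_funD.
  - move=> w _; rewrite -EFinD -EFinM lee_fin mul1r mulN1r.
    exact: normr_exp_le_expR.
have e0 t w : (0 <= (expR (t * L w))%:E)%E by rewrite lee_fin expR_ge0.
have mD := emeasurable_funD (mexp 1) (mexp (-1)).
have D0 w : setT w -> (0 <= (expR (1 * L w))%:E + (expR (-1 * L w))%:E)%E.
  by move=> _; exact: adde_ge0.
have m0' : (0 <= (m%:R ^+ m : R)%:E)%E by rewrite lee_fin exprn_ge0.
rewrite (ge0_integralZl _ measurableT mD D0 m0').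
rewrite (ge0_integralD _ measurableT (fun w _ => e0 1 w) (mexp 1)
  (fun w _ => e0 (-1) w) (mexp (-1))).
rewrite !(ge0_integral_law_expR mL v0 lawL) -EFinD -EFinM lee_fin.
apply: ler_wpM2l; first by rewrite exprn_ge0.
have e : expR (v / 2) <= expR (C / 2) by rewrite ler_expR; lra.
by rewrite sqrrN expr1n !mul1r; lra.
Qed.

(** * Characteristic functions of Gaussian matrices and of two independent copies *)

Section gaussian_chf.
Context (R : realType).

(** In terms of the variance the product rule reads [gchfD]. Variance 0 is split off as the Dirac
    mass, as in [centered_normal]. *)
Definition gchf (v : R) : R := if v == 0 then 1 else normal_chf (Num.sqrt v).

Lemma gchfD v w : 0 <= v -> 0 <= w -> gchf (v + w) = gchf v * gchf w.
Proof.
move=> v0 w0; rewrite /gchf.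
have [->|vn] := eqVneq v 0; first by rewrite add0r mul1r.
have [->|wn] := eqVneq w 0; first by rewrite addr0 (negbTE vn) mulr1.
have vp : 0 < v by rewrite lt_def vn.
have wp : 0 < w by rewrite lt_def wn.
rewrite gt_eqF ?addr_gt0// normal_chfM ?sqr_sqrtr//.
- by rewrite gt_eqF// sqrtr_gt0.
- by rewrite gt_eqF// sqrtr_gt0.
Qed.

Definition mdot n k (A B : 'M[R]_(n, k)) := \sum_(i < n) \sum_(j < k) A i j * B i j.

Definition qform n k (S : 'M[R]_k) (A : 'M[R]_(n, k)) :=
  \sum_(i < n) (row i A *m S *m (row i A)^T) 0 0.

Lemma qform_ge0 n k (S : 'M[R]_k) (A : 'M[R]_(n, k)) : psd S -> 0 <= qform S A.
Proof.
move=> [_ S0]; apply: sumr_ge0 => i _.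
by have := S0 (row i A)^T; rewrite trmxK.
Qed.

Context (d : measure_display) (T : measurableType d) (P : probability T R)
  (n k : nat) (S : 'M[R]_k) (Y : T -> 'M[R]_(n, k)).
Hypotheses (psdS : psd S) (gY : gaussian_mx P S Y).

Lemma measurable_mdot A : measurable_fun setT (fun w => mdot A (Y w)).
Proof.
apply: measurable_sum => i; apply: measurable_sum => j.
by apply: measurable_funM => //; exact: gY.1.
Qed.

Lemma bmeas_cos_mdot A : bmeas (fun w => cos (mdot A (Y w))).
Proof.
split; last by exists 1 => w; exact: cos_max.
apply: (measurableT_comp (f := cos)); last exact: measurable_mdot.
by apply: continuous_measurable_fun; exact: continuous_cos.
Qed.

Lemma bmeas_sin_mdot A : bmeas (fun w => sin (mdot A (Y w))).
Proof.
split; last by exists 1 => w; exact: sin_max.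
apply: (measurableT_comp (f := sin)); last exact: measurable_mdot.
by apply: continuous_measurable_fun; exact: continuous_sin.
Qed.

Lemma gaussian_mx_cos A : \int[P]_w cos (mdot A (Y w)) = gchf (qform S A).
Proof.
rewrite (Rintegral_law (measurable_mdot A) (gY.2 A)); last first.
  by have := bmeas_cos (0 : R); under eq_fun do rewrite addr0.
by rewrite cos0.
Qed.

Lemma gaussian_mx_sin A : \int[P]_w sin (mdot A (Y w)) = 0.
Proof.
rewrite (Rintegral_law (measurable_mdot A) (gY.2 A)); last exact: bmeas_sin.
case: ifPn => [_|q0]; first exact: sin0.
apply: integral_normal_prob_sin.
by rewrite gt_eqF// sqrtr_gt0 lt_def q0 (qform_ge0 A psdS).
Qed.

(** After the addition formulas, every term with a sine integrates to 0. The result sees [A] and [B]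
    only through the sum of two variances, the source of the row-exchange symmetry. *)
Lemma gaussian_mx_cos2 A B c :
  \int[(P \x P)%E]_w cos (mdot A (Y w.1) + mdot B (Y w.2) + c) =
  cos c * gchf (qform S A + qform S B).
Proof.
have bY (f : R -> R) (A' : 'M[R]_(n, k)) : bmeas (fun w => f (mdot A' (Y w))) ->
    bmeas (fun w : T * T => f (mdot A' (Y w.1))) /\
    bmeas (fun w : T * T => f (mdot A' (Y w.2))).
  move=> [mf [M bM]]; split; (split; last by exists M).
    exact: (measurableT_comp mf measurable_fst).
  exact: (measurableT_comp mf measurable_snd).
have bc A' := bY _ _ (bmeas_cos_mdot A').
have bs A' := bY _ _ (bmeas_sin_mdot A').
pose e1 w := cos (mdot A (Y w.1)) * cos (mdot B (Y w.2)) : R.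
pose e2 w := sin (mdot A (Y w.1)) * sin (mdot B (Y w.2)) : R.
pose e3 w := sin (mdot A (Y w.1)) * cos (mdot B (Y w.2)) : R.
pose e4 w := cos (mdot A (Y w.1)) * sin (mdot B (Y w.2)) : R.
have b1 : bmeas e1 by exact: bmeasM (bc A).1 (bc B).2.
have b2 : bmeas e2 by exact: bmeasM (bs A).1 (bs B).2.
have b3 : bmeas e3 by exact: bmeasM (bs A).1 (bc B).2.
have b4 : bmeas e4 by exact: bmeasM (bc A).1 (bs B).2.
have i1 : \int[(P \x P)%E]_w e1 w = gchf (qform S A + qform S B).
  rewrite (Rintegral_prod P P (bmeas_cos_mdot A) (bmeas_cos_mdot B)).
  by rewrite !gaussian_mx_cos gchfD ?qform_ge0.
have i2 : \int[(P \x P)%E]_w e2 w = 0.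
  rewrite (Rintegral_prod P P (bmeas_sin_mdot A) (bmeas_sin_mdot B)).
  by rewrite !gaussian_mx_sin mul0r.
have i3 : \int[(P \x P)%E]_w e3 w = 0.
  rewrite (Rintegral_prod P P (bmeas_sin_mdot A) (bmeas_cos_mdot B)).
  by rewrite gaussian_mx_sin mul0r.
have i4 : \int[(P \x P)%E]_w e4 w = 0.
  rewrite (Rintegral_prod P P (bmeas_cos_mdot A) (bmeas_sin_mdot B)).
  by rewrite gaussian_mx_sin mulr0.
transitivity (\int[(P \x P)%E]_w
    (cos c * (e1 w - e2 w) - sin c * (e3 w + e4 w))).
  by apply: eq_Rintegral => w _; rewrite !cosD sinD /e1 /e2 /e3 /e4; ring.
have ib f := @bmeas_integrable _ _ _ (P \x P)%E f.
have bB := bmeasB b1 b2; have bD := bmeasD b3 b4.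
rewrite RintegralB//; last 2 first.
- by apply: ib; apply: bmeasM => //; exact: bmeas_cst.
- by apply: ib; apply: bmeasM => //; exact: bmeas_cst.
rewrite !RintegralZl//; [|exact: ib..].
rewrite RintegralB//; [|exact: ib..].
rewrite RintegralD//; [|exact: ib..].
by rewrite i1 i2 i3 i4 addr0 mulr0 !subr0.
Qed.

End gaussian_chf.

Lemma sum_pair (V : nmodType) (I J : finType) (f : I * J -> V) :
  \sum_z f z = \sum_i \sum_j f (i, j).
Proof. by rewrite pair_bigA; apply: eq_bigr => -[]. Qed.

Lemma bmeas_lipschitz_mx (R : realType) (d : measure_display)
    (T : measurableType d) (P : probability T R) (n k : nat)
    (V : T -> 'M[R]_(n, k)) (F : 'M[R]_(n, k) -> R) (K M : R) :
  random_mx V -> 0 <= K ->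
  (forall A B, `|F A - F B| <= K * \sum_i \sum_j `|A i j - B i j|) ->
  (forall A, `|F A| <= M) -> bmeas (F \o V).
Proof.
move=> mV K0 lF bF.
have mV' (z : 'I_n * 'I_k) : measurable_fun setT (fun w => V w z.1 z.2).
  exact: mV.
have := @bmeas_lipschitz _ _ _ P _ (fun w z => V w z.1 z.2) K M
  (fun x => F (\matrix_(i, j) x (i, j))) mV' K0.
have -> : (fun x => F (\matrix_(i, j) x (i, j))) \o (fun w z => V w z.1 z.2) =
    F \o V.
  by apply/funext => w /=; congr F; apply/matrixP => i j; rewrite !mxE.
apply=> // x y; apply: le_trans (lF _ _) _; apply: ler_wpM2l => //.
rewrite sum_pair.
by apply: ler_sum => i _; apply: ler_sum => j _; rewrite !mxE.
Qed.

(** * Row exchange and the Efron-Stein inequality *)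

Section efron_stein.
Context (R : realType) (d : measure_display) (T : measurableType d)
  (P : probability T R) (n k : nat) (S : 'M[R]_k) (Y : T -> 'M[R]_(n, k)).
Hypotheses (psdS : psd S) (gY : gaussian_mx P S Y).

Local Notation idx := (bool * 'I_n * 'I_k)%type.
Local Notation PP := (P \x P)%E.

(* Two independent copies of [Y], indexed by the boolean. *)
Let W (w : T * T) (z : idx) : R := (if z.1.1 then Y w.1 else Y w.2) z.1.2 z.2.

(** Row [l] is exchanged between the two copies by toggling its copy label. *)
Let swap (l : 'I_n) (z : idx) : idx := (z.1.1 (+) (z.1.2 == l), z.1.2, z.2).

Let swapK l : involutive (swap l).
Proof. by move=> [[b i] j]; rewrite /swap /= -addbA addbb addbF. Qed.

Let measurable_W z : measurable_fun setT (fun w => W w z).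
Proof.
case: z => [[[] i] j]; rewrite /W /=.
  exact: (measurableT_comp (gY.1 i j) measurable_fst).
exact: (measurableT_comp (gY.1 i j) measurable_snd).
Qed.

Let coefs (a : idx -> R) b : 'M[R]_(n, k) := \matrix_(i, j) a (b, i, j).

Let dotW a w : \sum_z a z * W w z =
  mdot (coefs a true) (Y w.1) + mdot (coefs a false) (Y w.2).
Proof.
rewrite !sum_pair big_bool /=; congr (_ + _); rewrite /mdot; apply: eq_bigr => i _;
  by apply: eq_bigr => j _; rewrite mxE.
Qed.

(** The variance is a sum over rows with the same [S] in each, so exchanging a row of coefficients
    only permutes terms. Here the identity factor of the covariance is used. *)
Let qform_swap a l :
  qform S (coefs (a \o swap l) true) + qform S (coefs (a \o swap l) false) =
  qform S (coefs a true) + qform S (coefs a false).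
Proof.
rewrite /qform -!big_split; apply: eq_bigr => i _ /=.
have E b : row i (coefs (a \o swap l) b) = row i (coefs a (b (+) (i == l))).
  by apply/rowP => j; rewrite !mxE.
by rewrite !E; case: (i == l); rewrite // addrC.
Qed.

Lemma gaussian_swap (l : 'I_n) (K M : R) (F : (idx -> R) -> R) : 0 <= K ->
  (forall x y, `|F x - F y| <= K * \sum_i `|x i - y i|) ->
  (forall x, `|F x| <= M) ->
  \int[PP]_w F (W w) = \int[PP]_w F (W w \o swap l).
Proof.
move=> K0 lF bF.
have mW' z : measurable_fun setT (fun w => (W w \o swap l) z).
  exact: measurable_W.
refine (proj2 (@cramer_wold _ _ _ PP _ W (fun w => W w \o swap l)
  measurable_W mW' _ K M F K0 lF bF)) => a c.
under eq_Rintegral do rewrite dotW.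
rewrite (gaussian_mx_cos2 psdS gY).
have E w : \sum_z a z * (W w \o swap l) z = \sum_z (a \o swap l) z * W w z.
  rewrite (reindex_inj (inv_inj (swapK l))) /=.
  by apply: eq_bigr => z _; rewrite /= swapK.
under [RHS]eq_Rintegral do rewrite E dotW.
by rewrite (gaussian_mx_cos2 psdS gY) qform_swap.
Qed.

Let mix (p : 'I_n -> bool) (x : idx -> R) : 'M[R]_(n, k) :=
  \matrix_(i, j) x (p i, i, j).

(** The variance is the mean of h(Y) (h(Y) - h(Y')) for an independent copy Y'. The difference is
    telescoped by replacing one row at a time, and each of the [n] terms is at most c^2 / 2 by
    symmetrization in its row. *)
Lemma efron_stein (h : 'M[R]_(n, k) -> R) (K M c : R) : 0 <= K ->
  (forall A B, `|h A - h B| <= K * \sum_i \sum_j `|A i j - B i j|) ->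
  (forall A, `|h A| <= M) ->
  (forall (l : 'I_n) A B, (forall i, i != l -> row i A = row i B) ->
    `|h A - h B| <= c) ->
  \int[P]_w (h (Y w) - \int[P]_w h (Y w)) ^+ 2 <= n%:R * c ^+ 2 / 2.
Proof.
move=> K0 lh bh dh.
have M0 : 0 <= M by apply: le_trans (bh 0).
have lmix p x y : `|h (mix p x) - h (mix p y)| <= K * \sum_z `|x z - y z|.
  apply: le_trans (lh _ _) _; apply: ler_wpM2l => //.
  rewrite !sum_pair big_bool /= -big_split /=; apply: ler_sum => i _.
  rewrite -big_split /=; apply: ler_sum => j _; rewrite !mxE.
  by case: (p i); rewrite ?lerDl ?lerDr.
pose hm p x := h (mix p x).
have bm p : bmeas (fun w => hm p (W w)).
  exact: (@bmeas_lipschitz _ _ _ PP _ W K M (hm p) measurable_W K0 (lmix p)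
    (fun x => bh _)).
have bmS p l : bmeas (fun w => hm p (W w \o swap l)).
  exact: (@bmeas_lipschitz _ _ _ PP _ (fun w => W w \o swap l) K M (hm p)
    (fun z => measurable_W _) K0 (lmix p) (fun x => bh _)).
have ib f := @bmeas_integrable _ _ _ PP f.
have hmS p l x : hm p (x \o swap l) = hm (fun i => p i (+) (i == l)) x.
  by rewrite /hm; congr h; apply/matrixP => i j; rewrite !mxE.
pose T0 : 'I_n -> bool := fun=> true.
(* Rows below [m] come from the second copy: [q 0] is all of the first, [q n] all of the second. *)
pose q (m : nat) : 'I_n -> bool := fun i => (m <= i)%N.
pose F m x := hm T0 x * (hm (q m) x - hm (q m.+1) x).
have step m : (m < n)%N -> \int[PP]_w F m (W w) <= c ^+ 2 / 2.
  move=> mn; pose l := Ordinal mn.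
  have bF : bmeas (fun w => F m (W w)).
    by apply: bmeasM => //; exact: bmeasB.
  have bFS : bmeas (fun w => F m (W w \o swap l)).
    by apply: bmeasM => //; exact: bmeasB.
  (* [gaussian_swap] needs the product [F m] to be Lipschitz and bounded. *)
  have lF x y : `|F m x - F m y| <= (4 * M * K) * \sum_z `|x z - y z|.
    set D := \sum_z _.
    have -> : F m x - F m y = hm T0 x * (hm (q m) x - hm (q m) y) -
      hm T0 x * (hm (q m.+1) x - hm (q m.+1) y) +
      (hm T0 x - hm T0 y) * hm (q m) y - (hm T0 x - hm T0 y) * hm (q m.+1) y.
      by rewrite /F; ring.
    have D0 : 0 <= D by apply: sumr_ge0.
    have b1 p p' : `|hm p x * (hm p' x - hm p' y)| <= M * (K * D).
      by rewrite normrM ler_pM//; [exact: bh | exact: lmix].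
    have b2 p p' : `|(hm p x - hm p y) * hm p' y| <= M * (K * D).
      by rewrite mulrC normrM ler_pM//; [exact: bh | exact: lmix].
    have /ler_normlP[? ?] := b1 T0 (q m).
    have /ler_normlP[? ?] := b1 T0 (q m.+1).
    have /ler_normlP[? ?] := b2 T0 (q m).
    have /ler_normlP[? ?] := b2 T0 (q m.+1).
    by rewrite ler_norml; apply/andP; split; lra.
  have bdF x : `|F m x| <= M * (M + M).
    rewrite normrM ler_pM//; first exact: bh.
    by apply: le_trans (ler_normB _ _) _; rewrite lerD//; exact: bh.
  have K4 : 0 <= 4 * M * K by rewrite !mulr_ge0.
  have sw := gaussian_swap l K4 lF bdF.
  (* Exchanging row [m] in one of the two integrals swaps [q m] with [q m.+1], so the sum becomes a
     product of two one-row differences, each at most [c]. *)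
  suff : \int[PP]_w F m (W w) + \int[PP]_w F m (W w) <= c ^+ 2 by lra.
  rewrite {2}sw -RintegralD//; [|exact: ib..].
  rewrite -[leRHS](Rintegral_prob_cst PP); apply: le_Rintegral => //.
  - by apply: ib; exact: bmeasD.
  - by apply: ib; exact: bmeas_cst.
  move=> w _; rewrite /F !hmS.
  have -> : (fun i => q m i (+) (i == l)) = q m.+1.
    apply/funext => i; rewrite /q -val_eqE /=.
    by case: ltngtP.
  have -> : (fun i => q m.+1 i (+) (i == l)) = q m.
    apply/funext => i; rewrite /q -val_eqE /=.
    by case: ltngtP.
  have -> : hm T0 (W w) * (hm (q m) (W w) - hm (q m.+1) (W w)) +
      hm (fun i => T0 i (+) (i == l)) (W w) *
        (hm (q m.+1) (W w) - hm (q m) (W w)) =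
      (hm T0 (W w) - hm (fun i => T0 i (+) (i == l)) (W w)) *
        (hm (q m) (W w) - hm (q m.+1) (W w)) by ring.
  apply: le_trans (ler_norm _) _; rewrite normrM expr2 ler_pM//.
  - apply: (dh l) => i il; apply/rowP => j; rewrite !mxE (negbTE il).
    by rewrite addbF.
  - apply: (dh l) => i il; apply/rowP => j; rewrite !mxE /q.
    by move: il; rewrite -val_eqE /=; case: ltngtP.
have bh1 : bmeas (h \o Y) := bmeas_lipschitz_mx P gY.1 K0 lh bh.
set e := \int[P]_w h (Y w).
have i1 := bmeas_integrable P bh1.
have b2 : bmeas (fun w => h (Y w) ^+ 2) by exact: (bmeasM bh1 bh1).
have -> : \int[P]_w (h (Y w) - e) ^+ 2 = \int[P]_w (h (Y w) ^+ 2) - e ^+ 2.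
  transitivity (\int[P]_w (h (Y w) ^+ 2 - (2 * e) * h (Y w) + e ^+ 2)).
    by apply: eq_Rintegral => w _; ring.
  rewrite RintegralD//; last 2 first.
  - apply: bmeas_integrable; apply: bmeasB => //.
    by apply: bmeasM => //; exact: bmeas_cst.
  - exact: (bmeas_integrable _ (bmeas_cst _ _)).
  rewrite RintegralB//; last 2 first.
  - exact: bmeas_integrable.
  - by apply: bmeas_integrable; apply: bmeasM => //; exact: bmeas_cst.
  by rewrite Rintegral_prob_cst RintegralZl// -/e; ring.
have -> : \int[P]_w (h (Y w) ^+ 2) - e ^+ 2 =
    \int[PP]_w (\sum_(0 <= m < n) F m (W w)).
  have mT w : mix T0 (W w) = Y w.1 by apply/matrixP => i j; rewrite !mxE.
  have q0 : q 0%N = T0 by apply/funext => i; rewrite /q.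
  have mF w : mix (q n) (W w) = Y w.2.
    by apply/matrixP => i j; rewrite !mxE /q leqNgt ltn_ord.
  (* The factor 1 is the function of the second copy in the product form of [Rintegral_prod]. *)
  transitivity (\int[PP]_w (h (Y w.1) * h (Y w.1) * 1 - h (Y w.1) * h (Y w.2))).
    have b1 : bmeas (fun w : T => h (Y w) * h (Y w)) by exact: bmeasM.
    rewrite RintegralB//.
    - rewrite (Rintegral_prod P P b1 (@bmeas_cst _ _ _ 1)).
      by rewrite (Rintegral_prod P P bh1 bh1) Rintegral_prob_cst mulr1 expr2.
    - apply: ib; have := bmeasM (bm T0) (bm T0); rewrite /hm.
      by under eq_fun do rewrite mT -[_ * _]mulr1.
    - apply: ib; have := bmeasM (bm T0) (bm (q n)); rewrite /hm.
      by under eq_fun do rewrite mT mF.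
  apply: eq_Rintegral => w _; rewrite /F -mulr_sumr.
  rewrite (@telescope_sumr_eq _ _ _ (fun m => - hm (q m) (W w)))//; last first.
    by move=> m _; rewrite opprK addrC.
  by rewrite q0 /hm mT mF; ring.
under eq_Rintegral do rewrite big_mkord.
have sumF (s : seq 'I_n) :
    bmeas (fun w => \sum_(m <- s) F m (W w)) /\
    \int[PP]_w (\sum_(m <- s) F m (W w)) <= (size s)%:R * (c ^+ 2 / 2).
  elim: s => [|m s [bs IH]].
    under eq_fun do rewrite big_nil.
    by split; [exact: bmeas_cst | rewrite Rintegral_prob_cst mul0r].
  have bFm : bmeas (fun w => F m (W w)) by apply: bmeasM => //; exact: bmeasB.
  under eq_fun do rewrite big_cons.
  split; first exact: bmeasD.
  rewrite RintegralD//; [|exact: ib..].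
  rewrite /= -nat1r mulrDl mul1r lerD//; exact: step.
have := (sumF (enum 'I_n)).2; rewrite size_enum_ord mulrA.
by under eq_Rintegral do rewrite big_enum.
Qed.

End efron_stein.

(** * Normalized Frobenius norm and clipping of entries *)

Section frobenius.
Context (R : realType).

Definition nfrob n k (A : 'M[R]_(n, k)) : R := frob A / Num.sqrt n%:R.

Lemma frob_ge0 n k (A : 'M[R]_(n, k)) : 0 <= frob A.
Proof. exact: sqrtr_ge0. Qed.

Lemma nfrob_ge0 n k (A : 'M[R]_(n, k)) : 0 <= nfrob A.
Proof. by rewrite divr_ge0 ?frob_ge0 ?sqrtr_ge0. Qed.

Lemma sum_sqr_ge0 n k (A : 'M[R]_(n, k)) : 0 <= \sum_i \sum_j A i j ^+ 2.
Proof. by apply: sumr_ge0 => i _; apply: sumr_ge0 => j _; exact: sqr_ge0. Qed.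

Lemma sqr_frob n k (A : 'M[R]_(n, k)) : frob A ^+ 2 = \sum_i \sum_j A i j ^+ 2.
Proof. by rewrite sqr_sqrtr// sum_sqr_ge0. Qed.

Lemma sqr_nfrob n k (A : 'M[R]_(n, k)) :
  nfrob A ^+ 2 = (\sum_i \sum_j A i j ^+ 2) / n%:R.
Proof. by rewrite exprMn exprVn sqr_frob sqr_sqrtr. Qed.

Lemma frob0 n k : frob (0 : 'M[R]_(n, k)) = 0.
Proof.
apply/eqP; rewrite -sqrf_eq0 sqr_frob big1// => i _; rewrite big1// => j _.
by rewrite mxE expr0n.
Qed.

Lemma frobN n k (A : 'M[R]_(n, k)) : frob (- A) = frob A.
Proof.
congr Num.sqrt; apply: eq_bigr => i _; apply: eq_bigr => j _.
by rewrite mxE sqrrN.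
Qed.

Lemma frobB_sym n k (A B : 'M[R]_(n, k)) : frob (A - B) = frob (B - A).
Proof. by rewrite -frobN opprB. Qed.

(** Cauchy-Schwarz, by expanding the squared norm of [b A - a B] with [a], [b] the two norms.
    Dividing by [a b] forces the zero norms to be treated apart. *)
Lemma mdot_le_frob n k (A B : 'M[R]_(n, k)) : mdot A B <= frob A * frob B.
Proof.
have key (a b : R) : 0 < a -> 0 < b -> frob A = a -> frob B = b ->
    mdot A B <= a * b.
  move=> a0 b0 Aa Bb.
  have : 0 <= \sum_i \sum_j (b * A i j - a * B i j) ^+ 2.
    by apply: sumr_ge0 => i _; apply: sumr_ge0 => j _; exact: sqr_ge0.
  have -> : \sum_i \sum_j (b * A i j - a * B i j) ^+ 2 =
      b ^+ 2 * frob A ^+ 2 + a ^+ 2 * frob B ^+ 2 - 2 * a * b * mdot A B.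
    rewrite !sqr_frob /mdot !mulr_sumr -big_split -sumrB; apply: eq_bigr => i _ /=.
    rewrite !mulr_sumr -big_split -sumrB; apply: eq_bigr => j _ /=; ring.
  rewrite Aa Bb => h.
  have : 0 <= 2 * (a * b) * (a * b - mdot A B).
    by apply: le_trans h _; rewrite le_eqVlt; apply/orP; left; apply/eqP; ring.
  by rewrite pmulr_rge0 ?mulr_gt0// subr_ge0.
have dot0 (C D : 'M[R]_(n, k)) : frob C = 0 -> mdot C D = 0.
  move=> C0; rewrite /mdot big1// => i _; rewrite big1// => j _.
  have := sqr_frob C; rewrite C0 expr0n => /esym/eqP.
  rewrite psumr_eq0; last by move=> *; apply: sumr_ge0 => *; exact: sqr_ge0.
  move=> /allP/(_ i (mem_index_enum _)) /=.
  rewrite psumr_eq0; last by move=> *; exact: sqr_ge0.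
  move=> /allP/(_ j (mem_index_enum _)) /=; rewrite sqrf_eq0 => /eqP ->.
  by rewrite mul0r.
have dotC : mdot A B = mdot B A.
  by apply: eq_bigr => i _; apply: eq_bigr => j _; rewrite mulrC.
have [A0|A0] := eqVneq (frob A) 0; first by rewrite dot0// A0 mul0r.
have [B0|B0] := eqVneq (frob B) 0; first by rewrite dotC dot0// B0 mulr0.
by apply: key => //; rewrite lt_def ?A0 ?B0 frob_ge0.
Qed.

Lemma frobD n k (A B : 'M[R]_(n, k)) : frob (A + B) <= frob A + frob B.
Proof.
rewrite -ler_sqr ?nnegrE ?addr_ge0 ?frob_ge0//.
have -> : frob (A + B) ^+ 2 = frob A ^+ 2 + frob B ^+ 2 + 2 * mdot A B.
  rewrite !sqr_frob /mdot mulr_sumr -!big_split; apply: eq_bigr => i _ /=.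
  rewrite mulr_sumr -!big_split; apply: eq_bigr => j _ /=.
  by rewrite mxE; ring.
by have := mdot_le_frob A B; rewrite sqrrD mulr2n; lra.
Qed.

Lemma nfrobD n k (A B : 'M[R]_(n, k)) : nfrob (A + B) <= nfrob A + nfrob B.
Proof.
by rewrite -mulrDl ler_wpM2r ?invr_ge0 ?sqrtr_ge0 ?frobD.
Qed.

Lemma nfrobB_sym n k (A B : 'M[R]_(n, k)) : nfrob (A - B) = nfrob (B - A).
Proof. by rewrite /nfrob frobB_sym. Qed.

Lemma frob_le_sum n k (A : 'M[R]_(n, k)) : frob A <= \sum_i \sum_j `|A i j|.
Proof.
have s0 : 0 <= \sum_i \sum_j `|A i j| by apply: sumr_ge0 => i _; exact: sumr_ge0.
rewrite -ler_sqr ?nnegrE ?frob_ge0// sqr_frob expr2 mulr_suml.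
apply: ler_sum => i _; rewrite mulr_suml; apply: ler_sum => j _.
rewrite -(real_normK (num_real (A i j))) expr2; apply: ler_wpM2l => //.
rewrite (bigD1 i)//= (bigD1 j)//= -addrA lerDl addr_ge0 ?sumr_ge0//.
by move=> *; exact: sumr_ge0.
Qed.

Lemma nfrob_le_sum n k (A : 'M[R]_(n, k)) : (0 < n)%N ->
  nfrob A <= \sum_i \sum_j `|A i j|.
Proof.
move=> n0; apply: le_trans (frob_le_sum A).
rewrite ler_pdivrMr ?sqrtr_gt0 ?ltr0n// ler_peMr ?frob_ge0//.
by rewrite -[leLHS]sqrtr1 ler_sqrt// ler1n.
Qed.

Lemma nfrob_le_entries n k (A : 'M[R]_(n, k)) (K : R) : 0 <= K ->
  (forall i j, `|A i j| <= K) -> nfrob A <= K * Num.sqrt k%:R.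
Proof.
move=> K0 AK; rewrite -ler_sqr ?nnegrE ?nfrob_ge0 ?mulr_ge0 ?sqrtr_ge0//.
rewrite sqr_nfrob exprMn sqr_sqrtr//.
have [n0|n0] := posnP n.
  by rewrite [n in n%:R]n0 invr0 mulr0 mulr_ge0 ?sqr_ge0.
rewrite ler_pdivrMr ?ltr0n//.
apply: (@le_trans _ _ (\sum_(i < n) \sum_(j < k) K ^+ 2)).
  apply: ler_sum => i _; apply: ler_sum => j _.
  by rewrite -(real_normK (num_real (A i j))) ler_sqr ?nnegrE.
by rewrite !big_const_ord !iter_addr_0 mulr_natr mulr_natr.
Qed.

Lemma ler_nfrob n k (A B : 'M[R]_(n, k)) :
  (forall i j, `|A i j| <= `|B i j|) -> nfrob A <= nfrob B.
Proof.
move=> AB; rewrite -ler_sqr ?nnegrE ?nfrob_ge0// !sqr_nfrob.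
rewrite ler_wpM2r ?invr_ge0//; apply: ler_sum => i _; apply: ler_sum => j _.
by rewrite -(real_normK (num_real (A i j))) -(real_normK (num_real (B i j)))
   ler_sqr ?nnegrE.
Qed.

Definition clip (K x : R) : R := Num.max (- K) (Num.min K x).

Definition clipmx K n k (A : 'M[R]_(n, k)) := map_mx (clip K) A.

Lemma normr_clip K x : 0 <= K -> `|clip K x| <= K.
Proof.
move=> K0; rewrite ler_norml /clip le_max ge_max ge_min !lexx /= andbT; lra.
Qed.

Lemma clip_id K x : `|x| <= K -> clip K x = x.
Proof. by rewrite ler_norml /clip => /andP[? ?]; rewrite min_r// max_r. Qed.

Lemma clip_lip K x y : `|clip K x - clip K y| <= `|x - y|.
Proof.
wlog xy : x y / x <= y.
  move=> H; case: (leP x y) => [|/ltW] /H //.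
  by rewrite distrC (distrC x).
have cxy : clip K x <= clip K y.
  rewrite /clip ge_max !le_max lexx /=; apply/orP; right.
  by rewrite le_min ge_min lexx /= ge_min xy orbT.
rewrite !ler0_norm ?subr_le0// !opprB.
rewrite /clip; case: (leP K x) => Kx; case: (leP K y) => Ky;
  case: (leP (- K) K) => ?; case: (leP (- K) x) => ?;
  case: (leP (- K) y) => ?; lra.
Qed.

(** The error vanishes below [K], and above it x^2 <= x^4 / K^2. Bounded fourth moments thus make
    the clipping error small uniformly in [n]. *)
Lemma sqr_sub_clip K x : 0 < K -> (x - clip K x) ^+ 2 <= `|x| ^+ 4 / K ^+ 2.
Proof.
move=> K0; have [xK|Kx] := leP `|x| K.
  by rewrite clip_id// subrr expr0n divr_ge0 ?exprn_ge0// ltW.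
have h : `|x - clip K x| <= `|x|.
  move: Kx; rewrite /clip; case: (ger0P x) => x0 Kx.
    rewrite min_l ?(ltW Kx)// max_r; last by lra.
    by rewrite ger0_norm; lra.
  rewrite min_r; last by lra.
  rewrite max_l; last by lra.
  by rewrite ler0_norm; lra.
apply: (@le_trans _ _ (`|x| ^+ 2)).
  by rewrite -(real_normK (num_real (x - _))) ler_sqr ?nnegrE.
rewrite ler_pdivlMr ?exprn_gt0// (exprD `|x| 2 2) ler_wpM2l ?exprn_ge0//.
by rewrite ler_sqr ?nnegrE ?ltW// (lt_trans K0).
Qed.

Lemma normr_clip_le K x : 0 <= K -> `|clip K x| <= `|x|.
Proof.
move=> K0; have := clip_lip K x 0; rewrite subr0.
by rewrite [clip K 0]clip_id ?normr0// subr0.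
Qed.

End frobenius.

(** * Power mean inequality *)

Section power_mean.
Context (R : realFieldType).

Lemma expr_tangent (q : nat) (a m : R) : 0 <= a -> 0 <= m ->
  m ^+ q.+1 + q.+1%:R * m ^+ q * (a - m) <= a ^+ q.+1.
Proof.
move=> a0 m0; elim: q => [|q IH]; first by rewrite expr0 !expr1; lra.
have : 0 <= a * (a ^+ q.+1 - (m ^+ q.+1 + q.+1%:R * m ^+ q * (a - m))) +
    q.+1%:R * m ^+ q * (a - m) ^+ 2.
  rewrite addr_ge0//; first by rewrite mulr_ge0// subr_ge0.
  apply: mulr_ge0; last exact: sqr_ge0.
  by apply: mulr_ge0; [exact: ler0n | exact: exprn_ge0].
move=> h; rewrite -subr_ge0; apply: le_trans h _; rewrite le_eqVlt; apply/orP.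
by left; apply/eqP; rewrite -(natr1 q.+1) !exprS; ring.
Qed.

(** Jensen's inequality: when the tangent bound at the mean is summed, the linear terms cancel. *)
Lemma exprn_sum_le (I : finType) (a : I -> R) (q : nat) :
  (forall i, 0 <= a i) ->
  (\sum_i a i) ^+ q.+1 <= #|I|%:R ^+ q * \sum_i a i ^+ q.+1.
Proof.
move=> a0; have s0 : 0 <= \sum_i a i by apply: sumr_ge0.
have [I0|I0] := posnP #|I|.
  have := card0_eq I0 => e; rewrite !big1 ?expr0n ?mulr0// => i; by have := e i.
have N0 : 0 < #|I|%:R :> R by rewrite ltr0n.
pose m := (\sum_i a i) / #|I|%:R.
have m0 : 0 <= m by rewrite divr_ge0.
have sE : \sum_i a i = #|I|%:R * m by rewrite mulrCA divff ?mulr1// gt_eqF.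
have : \sum_i (m ^+ q.+1 + q.+1%:R * m ^+ q * (a i - m)) <=
    \sum_i a i ^+ q.+1 by apply: ler_sum => i _; exact: expr_tangent.
rewrite big_split /= -mulr_sumr sumrB !sumr_const sE -[m *+ _]mulr_natl subrr.
rewrite mulr0 addr0 -[_ *+ #|_|]mulr_natl => h.
by rewrite exprMn (exprSr #|I|%:R) -mulrA ler_pM2l ?exprn_gt0//.
Qed.

End power_mean.

(** * Pseudo-Lipschitz functions, their measurability and their inf-convolution *)

Definition pseudo_lipschitz (R : realType) n k (r : R) (psi : 'M[R]_(n, k) -> R) :=
  forall A B, `|psi A - psi B| <=
    nfrob (A - B) * (1 + nfrob A `^ (r - 1) + nfrob B `^ (r - 1)).

Section pseudo_lipschitz_theory.
Context (R : realType) (n k : nat) (r : R) (psi : 'M[R]_(n, k) -> R).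
Hypotheses (n0 : (0 < n)%N) (r1 : 1 <= r) (lpsi : pseudo_lipschitz r psi).

Let box (K : R) (A : 'M[R]_(n, k)) := forall i j, `|A i j| <= K.

Let box_clip K A : 0 <= K -> box K (clipmx K A).
Proof. by move=> K0 i j; rewrite mxE normr_clip. Qed.

(** Lipschitz constant on the box of size [K]. It is free of [n], because entries bounded by [K]
    force [nfrob] below K sqrt k. *)
Definition box_lip (K : R) : R := 1 + 2 * (K * Num.sqrt k%:R) `^ (r - 1).

Lemma box_lip_ge1 K : 1 <= box_lip K.
Proof. by rewrite lerDl mulr_ge0 ?powR_ge0. Qed.

Lemma ler_powR_nfrob (x y : R) : 0 <= x -> x <= y -> x `^ (r - 1) <= y `^ (r - 1).
Proof.
move=> x0 xy; apply: ge0_ler_powR => //; rewrite ?subr_ge0 ?nnegrE//.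
exact: le_trans xy.
Qed.

Lemma box_lipP K A B : 0 <= K -> box K A -> box K B ->
  `|psi A - psi B| <= box_lip K * nfrob (A - B).
Proof.
move=> K0 bA bB; apply: le_trans (lpsi A B) _.
rewrite mulrC ler_wpM2r ?nfrob_ge0// /box_lip.
have := ler_powR_nfrob (nfrob_ge0 A) (nfrob_le_entries K0 bA).
have := ler_powR_nfrob (nfrob_ge0 B) (nfrob_le_entries K0 bB).
by lra.
Qed.

Let psi_clip_lip K A B : 0 <= K ->
  `|psi (clipmx K A) - psi (clipmx K B)| <=
  box_lip K * \sum_i \sum_j `|A i j - B i j|.
Proof.
move=> K0; apply: le_trans (box_lipP K0 (box_clip A K0) (box_clip B K0)) _.
apply: ler_wpM2l; first exact: le_trans (box_lip_ge1 K).
apply: le_trans (nfrob_le_sum _ n0) _.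
by apply: ler_sum => i _; apply: ler_sum => j _; rewrite !mxE clip_lip.
Qed.

Let psi_clip_bound K A : 0 <= K ->
  `|psi (clipmx K A)| <= `|psi 0| + box_lip K * (K * Num.sqrt k%:R).
Proof.
move=> K0; rewrite -[X in `|X|](subrK (psi 0)) addrC.
apply: le_trans (ler_normD _ _) _; rewrite lerD2l.
have b0 : box K 0 by move=> i j; rewrite mxE normr0.
apply: le_trans (box_lipP K0 (box_clip A K0) b0) _.
apply: ler_wpM2l; first exact: le_trans (box_lip_ge1 K).
by rewrite subr0; apply: nfrob_le_entries => //; exact: box_clip.
Qed.

(** After clipping, [psi] is bounded and Lipschitz, hence measurable. At each point the clipped
    values are eventually constant as the level grows. *)
Lemma measurable_pseudo_lipschitz (d : measure_display) (T : measurableType d)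
    (P : probability T R) (V : T -> 'M[R]_(n, k)) :
  random_mx V -> measurable_fun setT (psi \o V).
Proof.
move=> mV; apply: (measurable_fun_cvg
    (h := fun m : nat => (fun A => psi (clipmx m%:R A)) \o V)).
  move=> m; have m0 : 0 <= m%:R :> R by [].
  by have [] := bmeas_lipschitz_mx P mV (le_trans ler01 (box_lip_ge1 m%:R))
    (fun A B => psi_clip_lip A B m0) (fun A => psi_clip_bound A m0).
move=> w _; apply: cvg_near_cst; near=> m => /=; congr psi.
apply/matrixP => i j; rewrite mxE clip_id//.
apply: (@le_trans _ _ (\sum_i \sum_j `|V w i j|)); last first.
  by apply: ltW; near: m; exact: nbhs_infty_gtr.
rewrite (bigD1 i)//= (bigD1 j)//= -addrA lerDl addr_ge0 ?sumr_ge0//.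
by move=> *; exact: sumr_ge0.
Unshelve. all: by end_near. Qed.

Section inf_convolution.
Context (K lam : R).
Hypotheses (K0 : 0 < K) (lam0 : 0 < lam).

Let cost (A B : 'M[R]_(n, k)) := psi B + lam * nfrob (clipmx K A - B) ^+ 2.

Let infc A := inf [set cost A B | B in box K].

Let L := box_lip K.
(** The maximum over [s] of L s - lam s^2, the most that the infimum can gain over
    [B = clipmx K A]. *)
Let eps := L ^+ 2 / (4 * lam).

Let cost_lb A B : box K B -> psi (clipmx K A) - eps <= cost A B.
Proof.
move=> bB; set s := nfrob (clipmx K A - B).
have := box_lipP (ltW K0) (box_clip A (ltW K0)) bB.
rewrite -/L -/s => /ler_normlP[_ h].
have : 0 <= (L / (2 * lam) - s) ^+ 2 * lam by rewrite mulr_ge0 ?sqr_ge0// ltW.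
have -> : (L / (2 * lam) - s) ^+ 2 * lam = eps - L * s + lam * s ^+ 2.
  by rewrite /eps; field; rewrite gt_eqF.
by rewrite /cost -/s; lra.
Qed.

Let infc_le A B : box K B -> infc A <= cost A B.
Proof.
move=> bB; apply: ge_inf; last by exists B.
by exists (psi (clipmx K A) - eps) => _ [B' bB' <-]; exact: cost_lb.
Qed.

Let le_infc A x : (forall B, box K B -> x <= cost A B) -> x <= infc A.
Proof.
move=> h; apply: lb_le_inf.
  by exists (cost A (clipmx K A)); exists (clipmx K A) => //; exact/box_clip/ltW.
by move=> _ [B bB <-]; exact: h.
Qed.

Let infc_close A : psi (clipmx K A) - eps <= infc A <= psi (clipmx K A).
Proof.
apply/andP; split; first by apply: le_infc => B; exact: cost_lb.
apply: le_trans (infc_le _ (box_clip A (ltW K0))) _.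
by rewrite /cost subrr /nfrob frob0 mul0r expr0n mulr0 addr0.
Qed.

Let infc_diff A A' e : (forall B, box K B -> `|cost A B - cost A' B| <= e) ->
  `|infc A - infc A'| <= e.
Proof.
move=> h; rewrite ler_norml; apply/andP; split.
  rewrite lerBrDr addrC; apply: le_infc => B bB.
  have := infc_le A' bB; have /ler_normlP[? ?] := h B bB; lra.
rewrite lerBlDr -lerBlDl; apply: le_infc => B bB.
have := infc_le A bB; have /ler_normlP[? ?] := h B bB; lra.
Qed.

Let cost_diff A A' B : box K B -> `|cost A B - cost A' B| <=
  lam / n%:R * \sum_i \sum_j `|(clip K (A i j) - B i j) ^+ 2 -
                               (clip K (A' i j) - B i j) ^+ 2|.
Proof.
move=> bB; rewrite /cost !sqr_nfrob.
set a := \sum_i _; set a' := \sum_i _; set D := \sum_i _.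
have -> : psi B + lam * (a / n%:R) - (psi B + lam * (a' / n%:R)) =
  lam / n%:R * (a - a') by ring.
rewrite normrM ger0_norm; last by rewrite divr_ge0// ltW.
apply: ler_wpM2l; first by rewrite divr_ge0// ltW.
rewrite /a /a' -sumrB; apply: le_trans (ler_norm_sum _ _ _) _.
apply: ler_sum => i _; rewrite -sumrB; apply: le_trans (ler_norm_sum _ _ _) _.
by apply: ler_sum => j _; rewrite !mxE.
Qed.

Let sqr_diff x y b : `|b| <= K ->
  `|(clip K x - b) ^+ 2 - (clip K y - b) ^+ 2| <= 4 * K * `|x - y| /\
  `|(clip K x - b) ^+ 2 - (clip K y - b) ^+ 2| <= 4 * K ^+ 2.
Proof.
move=> bK; have cx := normr_clip x (ltW K0); have cy := normr_clip y (ltW K0).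
split.
  have -> : (clip K x - b) ^+ 2 - (clip K y - b) ^+ 2 =
    (clip K x + clip K y - b - b) * (clip K x - clip K y) by ring.
  rewrite normrM; apply: ler_pM => //; last exact: clip_lip.
  move: cx cy bK => /ler_normlP[? ?] /ler_normlP[? ?] /ler_normlP[? ?].
  by rewrite ler_norml; apply/andP; split; lra.
have sq c : `|c| <= K -> 0 <= (c - b) ^+ 2 <= 4 * K ^+ 2.
  move=> cK; rewrite sqr_ge0 /=.
  have -> : 4 * K ^+ 2 = (2 * K) ^+ 2 by ring.
  rewrite -(real_normK (num_real (c - b))) ler_sqr ?nnegrE ?mulr_ge0 ?(ltW K0)//.
  by apply: le_trans (ler_normB _ _) _; lra.
have /andP[? ?] := sq _ cx; have /andP[? ?] := sq _ cy.
by rewrite ler_norml; apply/andP; split; lra.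
Qed.

(** The argument enters [cost] only through the quadratic term, a sum over entries times lam / n.
    Changing one row therefore moves the cost by at most (lam / n) k 4 K^2 for all competitors [B]
    at once, and so moves the infimum by no more. Competitors stay in the box to keep [psi]
    Lipschitz with constant [box_lip K]. *)
Lemma inf_convolution : exists h : 'M[R]_(n, k) -> R,
  [/\ forall A, `|psi (clipmx K A) - h A| <= box_lip K ^+ 2 / (4 * lam),
      exists2 K', 0 <= K' &
        forall A B, `|h A - h B| <= K' * \sum_i \sum_j `|A i j - B i j|,
      exists M, forall A, `|h A| <= M
    & forall (l : 'I_n) A B, (forall i, i != l -> row i A = row i B) ->
        `|h A - h B| <= 4 * lam * k%:R * K ^+ 2 / n%:R].
Proof.
have eps0 : 0 <= eps by rewrite divr_ge0 ?sqr_ge0// mulr_ge0// ltW.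
have ln0 : 0 <= lam / n%:R by rewrite divr_ge0// ltW.
exists infc; split.
- move=> A; have /andP[? ?] := infc_close A; rewrite -/eps.
  by rewrite ler_norml; apply/andP; split; lra.
- exists (lam / n%:R * (4 * K)); first by rewrite !mulr_ge0// ltW.
  move=> A A'; apply: infc_diff => B bB; apply: le_trans (cost_diff _ _ bB) _.
  rewrite -[leRHS]mulrA; apply: ler_wpM2l => //; rewrite mulr_sumr.
  apply: ler_sum => i _.
  rewrite mulr_sumr; apply: ler_sum => j _.
  exact: (sqr_diff _ _ (bB i j)).1.
- exists (`|psi 0| + box_lip K * (K * Num.sqrt k%:R) + eps) => A.
  have /andP[? ?] := infc_close A.
  have /ler_normlP[? ?] := psi_clip_bound A (ltW K0).
  by rewrite ler_norml; apply/andP; split; lra.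
- move=> l A A' AA'; apply: infc_diff => B bB.
  apply: le_trans (cost_diff _ _ bB) _.
  have -> : 4 * lam * k%:R * K ^+ 2 / n%:R = lam / n%:R * (4 * K ^+ 2 * k%:R).
    by ring.
  apply: ler_wpM2l => //; rewrite (bigD1 l)//= [X in _ + X]big1 ?addr0.
    rewrite mulr_natr -[in leRHS](card_ord k) -sumr_const; apply: ler_sum => j _.
    exact: (sqr_diff _ _ (bB l j)).2.
  move=> i il; rewrite big1// => j _.
  have /rowP/(_ j) := AA' i il; rewrite !mxE => ->.
  by rewrite subrr normr0.
Qed.

End inf_convolution.

End pseudo_lipschitz_theory.

(** * Gaussian moments and concentration with explicit parameters *)

Lemma Rintegral_sum_le (R : realType) (d : measure_display) (T : measurableType d)
    (P : probability T R) (I : finType) (f : I -> T -> R) (D : R) :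
  (forall i, P.-integrable setT (EFin \o f i)) ->
  (forall i, \int[P]_w f i w <= D) ->
  P.-integrable setT (EFin \o (fun w => \sum_i f i w)) /\
  \int[P]_w (\sum_i f i w) <= #|I|%:R * D.
Proof.
move=> fi fD.
have S (s : seq I) : P.-integrable setT (EFin \o (fun w => \sum_(i <- s) f i w)) /\
    \int[P]_w (\sum_(i <- s) f i w) <= (size s)%:R * D.
  elim: s => [|i s [IH1 IH2]].
    have -> : (fun w => \sum_(i <- [::]) f i w) = (fun=> 0).
      by apply/funext => w; rewrite big_nil.
    split; first exact: (bmeas_integrable P (@bmeas_cst _ _ T 0)).
    by rewrite Rintegral_prob_cst mul0r.
  have -> : (fun w => \sum_(j <- i :: s) f j w) =
      (fun w => f i w + \sum_(j <- s) f j w).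
    by apply/funext => w; rewrite big_cons.
  split.
    have := integrableD measurableT (fi i) IH1.
    by apply: eq_integrable => //.
  by rewrite RintegralD//= -nat1r mulrDl mul1r lerD.
have := S (enum I).
have -> : (fun w => \sum_(i <- enum I) f i w) = (fun w => \sum_i f i w).
  by apply/funext => w; rewrite big_enum.
by rewrite -cardE.
Qed.

Definition moment_bound (R : realType) (C : R) (m : nat) : R :=
  m%:R ^+ m * (2 * expR (C / 2)).

Section gaussian_concentration.
Context (R : realType) (d : measure_display) (T : measurableType d)
  (P : probability T R) (n k : nat) (S : 'M[R]_k) (Y : T -> 'M[R]_(n, k)) (C : R).
Hypotheses (psdS : psd S) (gY : gaussian_mx P S Y) (SC : forall j, S j j <= C).

Local Notation momentD := (moment_bound C).

Lemma gaussian_entry_moment (m : nat) (i : 'I_n) (j : 'I_k) : (0 < m)%N ->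
  P.-integrable setT (EFin \o (fun w => `|Y w i j| ^+ m)) /\
  \int[P]_w (`|Y w i j| ^+ m) <= momentD m.
Proof.
move=> m0.
have mdotE w : mdot (delta_mx i j) (Y w) = Y w i j.
  rewrite /mdot (bigD1 i)//= (bigD1 j)//= mxE !eqxx mul1r.
  rewrite big1 ?addr0; last first.
    by move=> j' /negbTE jj; rewrite mxE jj andbF mul0r.
  rewrite big1 ?addr0// => i' /negbTE ii; rewrite big1// => j' _.
  by rewrite mxE ii mul0r.
have qE : qform S (delta_mx i j : matrix R n k) = S j j.
  rewrite /qform (bigD1 i)//= big1 ?addr0; last first.
    move=> i' /negbTE ii.
    have -> : row i' (delta_mx i j) = 0 :> 'rV[R]_k.
      by apply/rowP => j'; rewrite !mxE ii.
    by rewrite !mul0mx mxE.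
  have -> : row i (delta_mx i j : 'M[R]_(n, k)) = delta_mx 0 j.
    by apply/rowP => j'; rewrite !mxE !eqxx.
  by rewrite -rowE trmx_delta -colE !mxE.
have law (B : set R) : measurable B ->
    P ((fun w => Y w i j) @^-1` B) = centered_normal (S j j) B.
  move=> mB.
  have -> : (fun w => Y w i j) = (fun w => mdot (delta_mx i j) (Y w)).
    by apply/funext => w; rewrite mdotE.
  by rewrite -qE; exact: (gY.2 (delta_mx i j) B mB).
have S0 : 0 <= S j j <= C by rewrite SC -qE qform_ge0.
have le := law_moment_le (gY.1 i j) S0 m0 law.
have mY : measurable_fun setT (fun w => `|Y w i j| ^+ m).
  by apply: measurable_funX; apply: measurableT_comp => //; exact: gY.1.
have int : P.-integrable setT (EFin \o (fun w => `|Y w i j| ^+ m)).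
  apply/integrableP; split; first exact/measurable_EFinP.
  apply: le_lt_trans (ltry (momentD m)).
  apply: le_trans le; rewrite le_eqVlt; apply/orP; left; apply/eqP.
  by apply: eq_integral => w _ /=; rewrite ger0_norm// exprn_ge0.
split=> //; rewrite -lee_fin /Rintegral fineK//.
exact: (integrable_fin_num measurableT).
Qed.

Lemma gaussian_moment_sum (m : nat) : (0 < m)%N ->
  P.-integrable setT (EFin \o (fun w => \sum_i \sum_j `|Y w i j| ^+ m)) /\
  \int[P]_w (\sum_i \sum_j `|Y w i j| ^+ m) <= n%:R * k%:R * momentD m.
Proof.
move=> m0.
have := @Rintegral_sum_le _ _ _ P ('I_n * 'I_k)%type
  (fun z w => `|Y w z.1 z.2| ^+ m) (momentD m)
  (fun z => (gaussian_entry_moment z.1 z.2 m0).1)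
  (fun z => (gaussian_entry_moment z.1 z.2 m0).2).
rewrite card_prod !card_ord natrM.
have -> // : (fun w => \sum_(z : 'I_n * 'I_k) `|Y w z.1 z.2| ^+ m) =
  (fun w => \sum_i \sum_j `|Y w i j| ^+ m).
by apply/funext => w; rewrite sum_pair.
Qed.

Context (r : R) (psi : 'M[R]_(n, k) -> R) (q : nat).
Hypotheses (n0 : (0 < n)%N) (r1 : 1 <= r) (lpsi : pseudo_lipschitz r psi).
Hypothesis rq : r - 1 <= q.+1%:R.

(** Passes from the real exponent to an integer one, for which the power mean inequality and
    [moment_bound] are available. *)
Let powR_le (s : R) : 0 <= s -> s `^ (r - 1) <= 1 + s ^+ q.+1.
Proof.
move=> s0; have [s1|/ltW s1] := leP s 1.
  apply: (@le_trans _ _ (1 `^ (r - 1))); first exact: ler_powR_nfrob.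
  by rewrite powR1 lerDl exprn_ge0.
apply: (@le_trans _ _ (s `^ q.+1%:R)); first exact: ler_powR.
by rewrite powR_mulrn// lerDr.
Qed.

(** The product a b of clipping distance and growth factor is split as t b^2 / 2 + a^2 / (2 t):
    fourth powers over K^2 control [a], powers of order 2 (q + 1) control [b]. The powers of [n] are
    such that both means are bounded independently of [n]. *)
Let psi_clip K t (A : 'M[R]_(n, k)) : 0 < K -> 0 < t ->
  `|psi A - psi (clipmx K A)| <=
  t / 2 * (18 + 8 * ((n%:R * k%:R) ^+ q / n%:R ^+ q.+1 *
     \sum_i \sum_j `|A i j| ^+ (2 * q.+1)))
  + (2 * t)^-1 * ((n%:R * K ^+ 2)^-1 * \sum_i \sum_j `|A i j| ^+ 4).
Proof.
move=> K0 t0; apply: le_trans (lpsi _ _) _.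
set a := nfrob _; set b := 1 + _ + _.
have a0 : 0 <= a by exact: nfrob_ge0.
have nR0 : 0 < n%:R :> R by rewrite ltr0n.
pose s := nfrob A; have s0 : 0 <= s by exact: nfrob_ge0.
have ha : a ^+ 2 <= (n%:R * K ^+ 2)^-1 * \sum_i \sum_j `|A i j| ^+ 4.
  rewrite /a sqr_nfrob invfM -mulrA mulrC ler_pM2l ?invr_gt0// mulr_sumr.
  apply: ler_sum => i _; rewrite mulr_sumr; apply: ler_sum => j _.
  by rewrite !mxE mulrC; exact: sqr_sub_clip.
have hb : 0 <= b <= 3 + 2 * s ^+ q.+1.
  have c : nfrob (clipmx K A) <= s.
    by apply: ler_nfrob => i j; rewrite mxE normr_clip_le// ltW.
  have := ler_powR_nfrob r1 (nfrob_ge0 _) c; have := powR_le s0.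
  have := powR_ge0 (nfrob (clipmx K A)) (r - 1); have := powR_ge0 s (r - 1).
  by rewrite /b -/s => ? ? ? ?; apply/andP; split; lra.
have hs : s ^+ (2 * q.+1) <= (n%:R * k%:R) ^+ q / n%:R ^+ q.+1 *
    \sum_i \sum_j `|A i j| ^+ (2 * q.+1).
  rewrite exprM sqr_nfrob expr_div_n mulrAC ler_pM2r ?invr_gt0 ?exprn_gt0//.
  have := @exprn_sum_le R ('I_n * 'I_k)%type (fun z => A z.1 z.2 ^+ 2) q
    (fun z => sqr_ge0 _).
  rewrite card_prod !card_ord natrM !sum_pair /= => h; apply: le_trans h _.
  rewrite le_eqVlt; apply/orP; left; apply/eqP; congr (_ * _).
  apply: eq_bigr => i _; apply: eq_bigr => j _.
  by rewrite exprM real_normK// num_real.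
(* From (3 + 2 u)^2 <= 2 * 9 + 2 * 4 u^2. *)
have hb2 : b ^+ 2 <= 18 + 8 * s ^+ (2 * q.+1).
  case/andP: hb => b0 hb; rewrite mulnC exprM.
  set u := s ^+ q.+1 in hb *; have u0 : 0 <= u by rewrite exprn_ge0.
  apply: (@le_trans _ _ ((3 + 2 * u) ^+ 2)).
    by rewrite ler_sqr ?nnegrE//; lra.
  by have := sqr_ge0 (3 - 2 * u); lra.
apply: (@le_trans _ _ (t / 2 * b ^+ 2 + (2 * t)^-1 * a ^+ 2)).
  rewrite -subr_ge0.
  have -> : t / 2 * b ^+ 2 + (2 * t)^-1 * a ^+ 2 - a * b =
      (t * b - a) ^+ 2 / (2 * t) by field; rewrite gt_eqF.
  by rewrite divr_ge0 ?sqr_ge0// mulr_ge0// ltW.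
apply: lerD; apply: ler_wpM2l => //; try by rewrite ?divr_ge0 ?invr_ge0 ?mulr_ge0// ltW.
by apply: le_trans hb2 _; rewrite lerD2l ler_pM2l.
Qed.

(** The center is the mean of the inf-convolution [h], bounded and hence integrable, because
    integrability of [psi] is itself a conclusion here. *)
Lemma gaussian_concentration_bound (K lam t t' : R) :
  0 < K -> 0 < lam -> 0 < t -> 0 < t' ->
  P.-integrable setT (EFin \o (psi \o Y)) /\
  exists m, \int[P]_w `|psi (Y w) - m| <=
    t / 2 * (18 + 8 * (k%:R ^+ q.+1 * momentD (2 * q.+1)))
    + (2 * t)^-1 * (k%:R * momentD 4 / K ^+ 2)
    + box_lip k r K ^+ 2 / (4 * lam)
    + (t' / 2 + (2 * t')^-1 *
        (n%:R * (4 * lam * k%:R * K ^+ 2 / n%:R) ^+ 2 / 2)).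
Proof.
move=> K0 lam0 t0 t'0.
have nR0 : 0 < n%:R :> R by rewrite ltr0n.
have [h [h1 [K' K'0 lh] [M bh] dh]] := inf_convolution r1 lpsi K0 lam0.
have es := efron_stein psdS gY K'0 lh bh dh.
set m := \int[P]_w h (Y w) in es.
have bhY : bmeas (h \o Y) := bmeas_lipschitz_mx P gY.1 K'0 lh bh.
have bv : bmeas (fun w => (h (Y w) - m) ^+ 2).
  by apply: bmeasM; apply: bmeasB => //; exact: bmeas_cst.
have iv := bmeas_integrable P bv.
pose G (p : nat) w := \sum_i \sum_j `|Y w i j| ^+ p.
have [i1 s1] : _ := @gaussian_moment_sum (2 * q.+1) isT.
have [i2 s2] : _ := @gaussian_moment_sum 4 isT.
pose c1 := (n%:R * k%:R) ^+ q / n%:R ^+ q.+1 : R.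
pose c2 := (n%:R * K ^+ 2)^-1 : R.
pose e := box_lip k r K ^+ 2 / (4 * lam).
(* Integrable pointwise majorant: clipping error, inf-convolution error [e], and t' / 2 + x^2 / (2
   t') for the deviation x = |h - m|, whose square Efron-Stein controls. *)
pose U w := (t / 2 * 18 + e + t' / 2) + t / 2 * 8 * c1 * G (2 * q.+1)%N w
  + (2 * t)^-1 * c2 * G 4%N w + (2 * t')^-1 * (h (Y w) - m) ^+ 2.
have UP w : `|psi (Y w) - m| <= U w.
  have : `|psi (Y w) - m| <= `|psi (Y w) - psi (clipmx K (Y w))| +
    `|psi (clipmx K (Y w)) - h (Y w)| + `|h (Y w) - m|.
    rewrite -!addrA; apply: le_trans (ler_distD (psi (clipmx K (Y w))) _ _) _.
    by rewrite lerD2l; exact: ler_distD.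
  have := psi_clip (Y w) K0 t0; have := h1 (Y w).
  set x := `|h _ - m|.
  have : x <= t' / 2 + (2 * t')^-1 * (h (Y w) - m) ^+ 2.
    rewrite -(real_normK (num_real (h (Y w) - m))) -/x -subr_ge0.
    have -> : t' / 2 + (2 * t')^-1 * x ^+ 2 - x = (t' - x) ^+ 2 / (2 * t').
      by field; rewrite gt_eqF.
    by rewrite divr_ge0 ?sqr_ge0// mulr_ge0// ltW.
  rewrite /U /G -/c1 -/c2 -/e; lra.
have iG1 : P.-integrable setT (EFin \o (fun w => t / 2 * 8 * c1 * G (2 * q.+1)%N w)).
  have := integrableZl measurableT (t / 2 * 8 * c1) i1.
  exact: eq_integrable.
have iG2 : P.-integrable setT (EFin \o (fun w => (2 * t)^-1 * c2 * G 4%N w)).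
  have := integrableZl measurableT ((2 * t)^-1 * c2) i2.
  exact: eq_integrable.
have iV : P.-integrable setT
    (EFin \o (fun w => (2 * t')^-1 * (h (Y w) - m) ^+ 2)).
  have := integrableZl measurableT ((2 * t')^-1) iv.
  exact: eq_integrable.
have icst c := bmeas_integrable P (@bmeas_cst _ _ T c).
have iU1 : P.-integrable setT (EFin \o (fun w => (t / 2 * 18 + e + t' / 2) +
    t / 2 * 8 * c1 * G (2 * q.+1)%N w)).
  have := integrableD measurableT (icst (t / 2 * 18 + e + t' / 2)) iG1.
  exact: eq_integrable.
have iU2 : P.-integrable setT (EFin \o (fun w => (t / 2 * 18 + e + t' / 2) +
    t / 2 * 8 * c1 * G (2 * q.+1)%N w + (2 * t)^-1 * c2 * G 4%N w)).
  have := integrableD measurableT iU1 iG2.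
  exact: eq_integrable.
have iU : P.-integrable setT (EFin \o U).
  have := integrableD measurableT iU2 iV.
  exact: eq_integrable.
have mpsi : measurable_fun setT (psi \o Y).
  exact: (measurable_pseudo_lipschitz n0 r1 lpsi P gY.1).
have ipsim : P.-integrable setT (EFin \o (fun w => psi (Y w) - m)).
  apply: le_integrable iU => //.
    by apply/measurable_EFinP; exact: measurable_funB.
  move=> w _ /=; rewrite lee_fin; apply: le_trans (UP w) _; exact: ler_norm.
split.
  have := integrableD measurableT ipsim (icst m).
  by apply: eq_integrable => // w _ /=; rewrite -EFinD subrK.
exists m; apply: (@le_trans _ _ (\int[P]_w U w)).
  by apply: le_Rintegral => //; exact: integrable_norm.
rewrite /U RintegralD// RintegralD// RintegralD// Rintegral_prob_cst.
rewrite !RintegralZl//.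
have c10 : 0 <= c1 by rewrite divr_ge0 ?exprn_ge0 ?mulr_ge0.
have c20 : 0 <= c2 by rewrite invr_ge0 mulr_ge0 ?exprn_ge0// ltW.
have k1 : t / 2 * 8 * c1 * \int[P]_w G (2 * q.+1)%N w <=
    t / 2 * 8 * (k%:R ^+ q.+1 * momentD (2 * q.+1)).
  rewrite -[leLHS]mulrA; apply: ler_wpM2l; first by rewrite mulr_ge0// divr_ge0// ltW.
  apply: le_trans (ler_wpM2l c10 s1) _.
  rewrite le_eqVlt; apply/orP; left; apply/eqP; rewrite /c1 exprMn !exprS.
  by field; rewrite expf_neq0 gt_eqF.
have k2 : (2 * t)^-1 * c2 * \int[P]_w G 4%N w <=
    (2 * t)^-1 * (k%:R * momentD 4 / K ^+ 2).
  rewrite -[leLHS]mulrA; apply: ler_wpM2l; first by rewrite invr_ge0 mulr_ge0// ltW.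
  apply: le_trans (ler_wpM2l c20 s2) _.
  rewrite le_eqVlt; apply/orP; left; apply/eqP; rewrite /c2.
  by field; rewrite !gt_eqF.
have k3 : (2 * t')^-1 * \int[P]_w (h (Y w) - m) ^+ 2 <= (2 * t')^-1 *
    (n%:R * (4 * lam * k%:R * K ^+ 2 / n%:R) ^+ 2 / 2).
  by rewrite ler_pM2l// invr_gt0 mulr_gt0.
rewrite -/e; lra.
Qed.

End gaussian_concentration.

(** * Convergence to 0, Markov's inequality and uniform concentration *)

Section ereal_cvg0.
Context (R : realType).

Lemma cvge0P (u : nat -> \bar R) : (forall n, 0 <= u n)%E ->
  (u @ \oo --> 0%E) <->
  (forall e : R, 0 < e -> exists N, forall n, (N <= n)%N -> (u n <= e%:E)%E).
Proof.
move=> u0; split.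
  move=> /fine_cvgP[ufin /cvgrPdist_le cv] e e0.
  have [N _ NP] : \forall n \near \oo, (u n <= e%:E)%E.
    near=> n; have ufn : u n \is a fin_num by near: n.
    rewrite -(fineK ufn) lee_fin; apply: le_trans (ler_norm _) _.
    have : `|0 - fine (u n)| <= e by near: n; exact: cv.
    by rewrite sub0r normrN.
  by exists N => n Nn; exact: NP.
move=> h; apply/fine_cvgP; split.
  have [N NP] := h 1 ltr01; exists N => // n Nn.
  by rewrite ge0_fin_numE// (le_lt_trans (NP n Nn))// ltry.
apply/cvgrPdist_le => e e0; have [N NP] := h e e0; exists N => // n Nn.
rewrite /= sub0r normrN ger0_norm ?fine_ge0// -lee_fin fineK ?NP//.
by rewrite ge0_fin_numE// (le_lt_trans (NP n Nn))// ltry.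
Unshelve. all: by end_near. Qed.

End ereal_cvg0.

Lemma markov_Rintegral (R : realType) (d : measure_display) (T : measurableType d)
    (P : probability T R) (Z : T -> R) (e : R) : 0 < e ->
  P.-integrable setT (EFin \o Z) ->
  (P [set w | (e < `|Z w|)%R] <= (e^-1 * \int[P]_w `|Z w|)%:E)%E.
Proof.
move=> e0 iZ; have mZ : measurable_fun setT Z.
  by apply/measurable_EFinP; case/integrableP: iZ.
have mA : measurable [set w | e < `|Z w|].
  rewrite -[X in measurable X]setTI.
  by apply: measurable_fun_ltr => //; exact: measurableT_comp.
have fA : P [set w | e < `|Z w|] \is a fin_num by exact: fin_num_measure.
rewrite -(fineK fA) lee_fin ler_pdivlMl//.
have -> : e * fine (P [set w | e < `|Z w|]) =
    \int[P]_w (e * \1_[set w | e < `|Z w|] w).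
  rewrite RintegralZl//; first by rewrite /Rintegral integral_indic// setIT.
  exact: integrable_indic.
apply: le_Rintegral => //; last 2 first.
- exact: integrable_norm.
- move=> w _; rewrite indicE; case: (boolP (w \in _)) => [|_]; last by rewrite mulr0.
  by rewrite inE /= mulr1 => /ltW.
- apply: bmeas_integrable; split; last first.
    exists e => w; rewrite normrM (ger0_norm (ltW e0)) ler_piMr ?(ltW e0)//.
    by rewrite indicE; case: (_ \in _); rewrite ?normr1 ?normr0.
  by apply: measurable_funM => //; exact: measurable_indic.
Qed.

(** The parameters are fixed in the order t, K, lam, t', each against constants already known, and
    [n] comes last. *)
Lemma gaussian_concentration (R : realType) (k : nat) (C r eta : R) :
  1 <= r -> 0 < eta -> exists N, forall n, (N <= n)%N ->
  forall (d : measure_display) (T : measurableType d) (P : probability T R)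
    (S : 'M[R]_k) (Y : T -> 'M[R]_(n, k)) (psi : 'M[R]_(n, k) -> R),
  psd S -> (forall j, S j j <= C) -> gaussian_mx P S Y ->
  pseudo_lipschitz r psi ->
  P.-integrable setT (EFin \o (psi \o Y)) /\
  \int[P]_w `|psi (Y w) - \int[P]_w psi (Y w)| <= eta.
Proof.
move=> r1 eta0.
pose q := Num.truncn r.
have rq : r - 1 <= q.+1%:R by rewrite lerBlDr; apply: ltW; rewrite ltr_wpDr// truncnS_gt.
(* Half of [eta] goes to the deviation from [m], the other half to replacing [m] by the mean. Within
   [e], the three approximation terms get e / 4 each, and t' / 2 and B3 / n get e / 8 each. *)
pose e := eta / 2; have e0 : 0 < e by rewrite divr_gt0.
have D0 m : 0 <= moment_bound C m by rewrite /moment_bound !mulr_ge0 ?exprn_ge0 ?expR_ge0.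
pose B1 := 18 + 8 * (k%:R ^+ q.+1 * moment_bound C (2 * q.+1)).
have B10 : 0 < B1 by rewrite ltr_pwDl// !mulr_ge0 ?exprn_ge0.
pose t := e / (2 * B1).
have t0 : 0 < t by rewrite divr_gt0// mulr_gt0.
have tE : t / 2 * B1 = e / 4 by rewrite /t; field; rewrite gt_eqF.
pose B2 := k%:R * moment_bound C 4.
have B20 : 0 <= B2 by rewrite mulr_ge0.
have [K K0 KE] : exists2 K : R, 0 < K & (2 * t)^-1 * (B2 / K ^+ 2) <= e / 4.
  (* With K = 1 + a the term is (e / 4) a / (1 + a)^2, and a <= (1 + a)^2. *)
  have [a a0 B2E] : exists2 a, 0 <= a & B2 = a * t * e / 2.
    exists (2 * B2 / (t * e)); last by field; rewrite !gt_eqF.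
    by apply: divr_ge0; apply: mulr_ge0 => //; exact: ltW.
  have a1 : 0 < 1 + a by rewrite ltr_pwDl.
  exists (1 + a) => //.
  have -> : (2 * t)^-1 * (B2 / (1 + a) ^+ 2) = e / 4 * (a / (1 + a) ^+ 2).
    by rewrite B2E; field; rewrite !gt_eqF.
  apply: ler_piMr; first by apply: divr_ge0 => //; exact: ltW.
  rewrite ler_pdivrMr ?exprn_gt0// mul1r.
  by have := sqr_ge0 a; nra.
pose L := box_lip k r K; have L1 : 1 <= L by exact: box_lip_ge1.
have L0 : 0 < L by exact: lt_le_trans L1.
pose lam := L ^+ 2 / e; have lam0 : 0 < lam by rewrite divr_gt0// exprn_gt0.
have lamE : L ^+ 2 / (4 * lam) = e / 4 by rewrite /lam; field; rewrite !gt_eqF.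
pose t' := e / 4; have t'0 : 0 < t' by rewrite divr_gt0.
pose B3 := (4 * lam * k%:R * K ^+ 2) ^+ 2 / (4 * t').
have B30 : 0 <= B3 by rewrite divr_ge0 ?sqr_ge0// mulr_ge0// ltW.
exists (Num.truncn (B3 / (e / 8))).+1 => n Nn d T P S Y psi psdS SC gY lpsi.
have n0 : (0 < n)%N by exact: leq_trans Nn.
have nR0 : 0 < n%:R :> R by rewrite ltr0n.
have nE : B3 / n%:R <= e / 8.
  rewrite ler_pdivrMr// mulrC -ler_pdivrMr ?divr_gt0//.
  by apply/ltW/(lt_le_trans (truncnS_gt _)); rewrite ler_nat.
have [iY [m mP]] := gaussian_concentration_bound psdS gY SC n0 r1 lpsi rq
  K0 lam0 t0 t'0.
split=> //.
have mle : \int[P]_w `|psi (Y w) - m| <= e.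
  apply: le_trans mP _; rewrite -/B1 tE -/B2 -/L lamE.
  have -> : (2 * t')^-1 * (n%:R * (4 * lam * k%:R * K ^+ 2 / n%:R) ^+ 2 / 2) =
      B3 / n%:R by rewrite /B3; field; rewrite !gt_eqF.
  have : t' / 2 = e / 8 by rewrite /t'; field.
  by lra.
have icst c := bmeas_integrable P (@bmeas_cst _ _ T c).
have im c : P.-integrable setT (EFin \o (fun w => psi (Y w) - c)).
  have := integrableB measurableT iY (icst c).
  exact: eq_integrable.
set E := \int[P]_w psi (Y w).
have Em : `|m - E| <= e.
  rewrite distrC; have <- : \int[P]_w (psi (Y w) - m) = E - m.
    by rewrite RintegralB// Rintegral_prob_cst.
  exact: le_trans (le_normr_Rintegral measurableT (im m)) mle.
apply: (@le_trans _ _ (\int[P]_w (`|psi (Y w) - m| + `|m - E|))).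
  apply: le_Rintegral => //.
  - exact: integrable_norm.
  - have := integrableD measurableT (integrable_norm (im m)) (icst `|m - E|).
    exact: eq_integrable.
  - by move=> w _; exact: ler_distD.
rewrite RintegralD//; last exact: integrable_norm.
by rewrite Rintegral_prob_cst /e in mle Em *; lra.
Qed.

(** * The Borel sigma-algebra on matrices *)

Section borel_matrices.
Context (R : realType) (n k : nat).

(** The generator inside [mx_borel] gets a name, so that the matrix space becomes a measurable
    type. *)
Definition mx_gen : set (set 'M[R]_(n, k)) :=
  [set A | exists (i : 'I_n) (j : 'I_k) (B : set R),
     measurable B /\ A = (fun M : 'M[R]_(n, k) => M i j) @^-1` B].

Local Notation borel_mx := (g_sigma_algebraType mx_gen).

Lemma measurable_random_mx (d : measure_display) (T : measurableType d)
    (V : T -> 'M[R]_(n, k)) (A : set 'M[R]_(n, k)) :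
  random_mx V -> mx_borel A -> measurable (V @^-1` A).
Proof.
move=> mV mA.
have mV' : measurable_fun setT (V : T -> borel_mx).
  apply: (@measurability _ _ T borel_mx setT V mx_gen) => // _ [_ [i [j [B [mB ->]]]] <-].
  rewrite setTI; have := mV i j measurableT B mB; rewrite setTI; exact.
by have := mV' measurableT A mA; rewrite setTI.
Qed.

Lemma random_mx_id : random_mx (fun A : borel_mx => A : 'M[R]_(n, k)).
Proof.
move=> i j _ B mB; rewrite setTI; apply: sub_sigma_algebra.
by exists i, j, B.
Qed.

(** Measurability of [psi] of a random matrix, applied to the identity of the matrix space under a
    Dirac mass. *)
Lemma mx_borel_preimage (psi : 'M[R]_(n, k) -> R) r B : (0 < n)%N -> 1 <= r ->
  pseudo_lipschitz r psi -> measurable B -> mx_borel (psi @^-1` B).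
Proof.
move=> n0 r1 lpsi mB.
have := measurable_pseudo_lipschitz n0 r1 lpsi (\d_(0 : borel_mx)) random_mx_id.
by move=> /(_ measurableT B mB); rewrite setTI.
Qed.

End borel_matrices.

(** * Couplings of two finite mass distributions *)

Section finite_coupling.
Context (R : realType) (I : finType) (p q : I -> R) (close : rel I).
Hypotheses (p0 : forall i, 0 <= p i) (q0 : forall j, 0 <= q j).

Let row_ (f : I -> I -> R) i := \sum_j f i j.
Let col_ (f : I -> I -> R) j := \sum_i f i j.

Let subcoupling (f : I -> I -> R) :=
  [/\ forall i j, 0 <= f i j, forall i, row_ f i <= p i,
      forall j, col_ f j <= q j & forall i j, f i j != 0 -> close i j].

(** Each close pair in turn receives the smaller of its two residual masses, which saturates a row
    or a column. Saturation persists, since later steps only add mass within the constraints. *)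
Let greedy (s : seq (I * I)) : exists2 f, subcoupling f &
  forall z, z \in s -> close z.1 z.2 -> row_ f z.1 = p z.1 \/ col_ f z.2 = q z.2.
Proof.
elim: s => [|[a b] s [f [f0 fp fq fc] fs]].
  exists (fun _ _ => 0) => //; split=> //.
  - by move=> i; rewrite /row_ big1.
  - by move=> j; rewrite /col_ big1.
  - by move=> i j; rewrite eqxx.
have [ab|ab] := boolP (close a b); last first.
  exists f; first by split.
  by move=> z; rewrite inE => /predU1P[-> /=|/fs//]; rewrite (negbTE ab).
pose t := Num.min (p a - row_ f a) (q b - col_ f b).
have t0 : 0 <= t by rewrite le_min !subr_ge0 fp fq.
have tp : t <= p a - row_ f a by rewrite ge_min lexx.
have tq : t <= q b - col_ f b by rewrite ge_min lexx orbT.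
pose g i j := f i j + (if (i == a) && (j == b) then t else 0).
have rowg i : row_ g i = row_ f i + (if i == a then t else 0).
  rewrite /row_ /g big_split /=; congr (_ + _).
  rewrite (bigD1 b)//= eqxx andbT big1 ?addr0// => j /negbTE ->.
  by rewrite andbF.
have colg j : col_ g j = col_ f j + (if j == b then t else 0).
  rewrite /col_ /g big_split /=; congr (_ + _).
  by rewrite (bigD1 a)//= eqxx /= big1 ?addr0// => i /negbTE ->.
exists g.
  split.
  - by move=> i j; rewrite addr_ge0//; case: ifP.
  - by move=> i; rewrite rowg; case: eqP => [->|_]; [lra | rewrite addr0].
  - by move=> j; rewrite colg; case: eqP => [->|_]; [lra | rewrite addr0].
  - move=> i j; rewrite /g; case: ifPn => [/andP[/eqP-> /eqP->]//|_].
    by rewrite addr0; exact: fc.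
move=> [i j]; rewrite inE => /predU1P[[-> ->] _ /=|zs cz /=].
  rewrite rowg colg !eqxx; have [h|h] := leP (p a - row_ f a) (q b - col_ f b).
    by left; rewrite /t min_l//; lra.
  by right; rewrite /t min_r ?ltW//; lra.
have /= [h|h] := fs _ zs cz; [left|right].
  rewrite rowg h; case: eqP => [ia|]; last by rewrite addr0.
  by move: tp; rewrite -ia h; lra.
rewrite colg h; case: eqP => [jb|]; last by rewrite addr0.
by move: tq; rewrite -jb h; lra.
Qed.

(* A maximal sub-coupling supported on close pairs; the unmatched masses live
   on sets without close pairs and are coupled independently. *)
Lemma finite_coupling : \sum_i p i = 1 -> \sum_j q j = 1 ->
  exists f : I -> I -> R, exists A B : {set I},
  [/\ [/\ forall i j, 0 <= f i j, forall i, \sum_j f i j = p i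
       & forall j, \sum_i f i j = q j],
      forall i j, i \in A -> j \in B -> ~~ close i j,
      \sum_i \sum_(j | ~~ close i j) f i j <= \sum_(i in A) p i
    & \sum_i \sum_(j | ~~ close i j) f i j <= \sum_(j in B) q j].
Proof.
move=> p1 q1; have [f [f0 fp fq fc] fs] := greedy (enum {: I * I}).
pose u i := p i - row_ f i; pose v j := q j - col_ f j.
have u0 i : 0 <= u i by rewrite subr_ge0.
have v0 j : 0 <= v j by rewrite subr_ge0.
pose m := \sum_i u i.
have m0 : 0 <= m by apply: sumr_ge0.
have vm : \sum_j v j = m.
  by rewrite /m /u /v !sumrB p1 q1 /row_ /col_ exchange_big.
(* The residuals [u] and [v] have the same total [m]. If [m = 0] both vanish and the quotient is 0
   by convention. *)
pose g i j := f i j + u i * v j / m.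
have uz i : m = 0 -> u i = 0.
  move=> mz; apply/eqP; rewrite eq_le u0 andbT -mz /m (bigD1 i)//= lerDl.
  exact: sumr_ge0.
have vz j : m = 0 -> v j = 0.
  move=> mz; apply/eqP; rewrite eq_le v0 andbT -mz -vm (bigD1 j)//= lerDl.
  exact: sumr_ge0.
have g0 i j : 0 <= g i j by rewrite addr_ge0// divr_ge0// mulr_ge0.
have bad : \sum_i \sum_(j | ~~ close i j) g i j <= m.
  apply: (@le_trans _ _ (\sum_i \sum_j u i * v j / m)).
    apply: ler_sum => i _; rewrite [leRHS](bigID (close i))/=.
    apply: (@le_trans _ _ (\sum_(j | ~~ close i j) u i * v j / m)).
      apply: ler_sum => j cij; rewrite /g.
      have -> : f i j = 0 by apply/eqP; apply: contraNT cij; exact: fc.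
      by rewrite add0r.
    rewrite lerDr; apply: sumr_ge0 => j _; by rewrite divr_ge0// mulr_ge0.
  have [mz|mz] := eqVneq m 0.
    by rewrite big1// => i _; rewrite big1// => j _; rewrite uz// !mul0r.
  rewrite le_eqVlt; apply/orP; left; apply/eqP.
  under eq_bigr do rewrite -mulr_suml -mulr_sumr vm mulfK//.
  by [].
(* The supports of the residuals: a close pair between them would contradict saturation. *)
exists g, (finset (fun i => u i != 0)), (finset (fun j => v j != 0)); split.
- split=> //.
  + move=> i; rewrite big_split /= -mulr_suml -mulr_sumr vm.
    have [mz|mz] := eqVneq m 0.
      by rewrite uz// !mul0r addr0; have := uz i mz; rewrite /u /row_; lra.
    by rewrite mulfK// /u /row_; lra.
  + move=> j; rewrite big_split /= -mulr_suml -mulr_suml -/m.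
    have [mz|mz] := eqVneq m 0.
      by rewrite vz// mulr0 mul0r addr0; have := vz j mz; rewrite /v /col_; lra.
    by rewrite mulrAC divff// mul1r /v /col_; lra.
- move=> i j; rewrite !inE => ui vj; apply/negP => cij.
  have [] := fs (i, j) (mem_enum _ _) cij => /= h.
    by move: ui; rewrite /u h subrr eqxx.
  by move: vj; rewrite /v h subrr eqxx.
- apply: le_trans bad _; rewrite /m (bigID (mem (finset (fun i => u i != 0))))/=.
  rewrite [X in _ + X]big1 ?addr0; last first.
    by move=> i; rewrite inE negbK => /eqP.
  by apply: ler_sum => i _; rewrite /u lerBlDr lerDl; apply: sumr_ge0.
- apply: le_trans bad _; rewrite -vm (bigID (mem (finset (fun j => v j != 0))))/=.
  rewrite [X in _ + X]big1 ?addr0; last first.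
    by move=> i; rewrite inE negbK => /eqP.
  by apply: ler_sum => i _; rewrite /v lerBlDr lerDl; apply: sumr_ge0.
Qed.

End finite_coupling.

(** * Finite partitions and couplings with prescribed cell masses *)

Section cells.
Context (R : realType) (d : measure_display) (T : measurableType d)
  (P : probability T R) (I : finType) (c : T -> I).
Hypothesis mc : forall i, measurable (c @^-1` [set i]).

Let cells_seq (A : set T) (s : seq I) : measurable A -> uniq s ->
  measurable [set w | c w \in s] /\
  \sum_(i <- s) fine (P (A `&` c @^-1` [set i])) =
  fine (P (A `&` [set w | c w \in s])).
Proof.
move=> mA; elim: s => [_|i s IH /= /andP[is_ us]].
  have -> : [set w | c w \in [::]] = set0 by apply/seteqP; split.
  by rewrite setI0 measure0 big_nil.
have [ms E] := IH us.
have S : [set w | c w \in i :: s] = c @^-1` [set i] `|` [set w | c w \in s].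
  apply/seteqP; split => w /=; rewrite inE.
    by move=> /predU1P[->|]; [left | right].
  by move=> [->|->]; rewrite ?eqxx ?orbT.
split; first by rewrite S; exact: measurableU.
rewrite big_cons E S setIUr measureU; last 3 first.
- exact: measurableI.
- exact: measurableI.
- rewrite -subset0 => w [[_ /= ci] [_ /= cs]].
  by move: is_; rewrite -ci cs.
by rewrite fineD// fin_num_measure//; exact: measurableI.
Qed.

Lemma measurable_cells (D : pred I) : measurable [set w | D (c w)].
Proof.
have [+ _] := @cells_seq setT (enum D) measurableT (enum_uniq _).
by congr (measurable _); apply/seteqP; split => w /=; rewrite mem_enum.
Qed.

Lemma prob_cells (D : pred I) A : measurable A ->
  \sum_(i | D i) fine (P (A `&` c @^-1` [set i])) =
  fine (P (A `&` [set w | D (c w)])).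
Proof.
move=> mA; have [_ E] := @cells_seq A (enum D) mA (enum_uniq _).
rewrite -big_enum E; congr (fine (P (_ `&` _))).
by apply/seteqP; split => w /=; rewrite mem_enum.
Qed.

End cells.

Section cell_coupling.
Context (R : realType) (d1 d2 : measure_display) (T1 : measurableType d1)
  (T2 : measurableType d2) (P1 : probability T1 R) (P2 : probability T2 R)
  (I : finType) (o : I) (c1 : T1 -> I) (c2 : T2 -> I) (f : I -> I -> R).
Hypothesis mc1 : forall i, measurable (c1 @^-1` [set i]).
Hypothesis mc2 : forall i, measurable (c2 @^-1` [set i]).

Let p i := fine (P1 (c1 @^-1` [set i])).
Let q j := fine (P2 (c2 @^-1` [set j])).

Hypothesis f0 : forall i j, 0 <= f i j.
Hypothesis fp : forall i, \sum_j f i j = p i.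
Hypothesis fq : forall j, \sum_i f i j = q j.

Let p0 i : 0 <= p i. Proof. exact: fine_ge0. Qed.
Let q0 i : 0 <= q i. Proof. exact: fine_ge0. Qed.

Let cell (z : I * I) : set (T1 * T2) :=
  (c1 @^-1` [set z.1]) `*` (c2 @^-1` [set z.2]).

Let mcell z : measurable (cell z).
Proof. exact: measurableX. Qed.

(** Density with respect to the product law, constant on each pair of cells: given the cells, the
    two points are independent with their conditional laws. On a null cell the quotient is 0,
    consistent with [f] vanishing there ([fz1], [fz2]). *)
Let weight (z : I * I) : R := f z.1 z.2 / (p z.1 * q z.2).

Let weight_ge0 z : 0 <= weight z.
Proof. by rewrite divr_ge0// mulr_ge0. Qed.

Let PP : probability (T1 * T2)%type R := (P1 \x P2)%E.

Let pairs := enum {: I * I}.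
Let nthp (m : nat) := nth (o, o) pairs m.

(** [msum] indexes by naturals, so the pairs of cells are enumerated, with [o] in the default value
    of [nth]. *)
Let part (m : nat) : {measure set (T1 * T2) -> \bar R} :=
  mscale (NngNum (weight_ge0 (nthp m))) (mrestr PP (mcell (nthp m))).

Definition cell_measure : set (T1 * T2) -> \bar R := msum part (size pairs).

HB.instance Definition _ := Measure.on cell_measure.

Lemma cell_measureE A : measurable A ->
  cell_measure A = (\sum_(z : I * I) weight z * fine (PP (A `&` cell z)))%:E.
Proof.
move=> mA; rewrite /cell_measure /msum.
transitivity (\sum_(z <- pairs) ((weight z)%:E * PP (A `&` cell z)))%E.
  by rewrite (big_nth (o, o)) big_mkord.
rewrite big_enum /= -sumEFin; apply: eq_bigr => z _.
rewrite [RHS]EFinM; congr (_ * _)%E.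
have fin : PP (A `&` cell z) \is a fin_num.
  exact: (fin_num_measure PP _ (measurableI _ _ mA (mcell z))).
by rewrite fineK.
Qed.

Let fz1 i j : p i = 0 -> f i j = 0.
Proof.
move=> pi0; apply/eqP; rewrite eq_le f0 andbT -pi0 -fp (bigD1 j)//= lerDl.
exact: sumr_ge0.
Qed.

Let fz2 i j : q j = 0 -> f i j = 0.
Proof.
move=> qj0; apply/eqP; rewrite eq_le f0 andbT -qj0 -fq (bigD1 i)//= lerDl.
exact: sumr_ge0.
Qed.

Let PPX A B : measurable A -> measurable B ->
  fine (PP (A `*` B)) = fine (P1 A) * fine (P2 B).
Proof.
by move=> mA mB; rewrite [PP _]product_measure1E// fineM// fin_num_measure.
Qed.

Let weightr i j : weight (i, j) * q j = f i j / p i.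
Proof.
rewrite /weight /=; have [qj0|qj0] := eqVneq (q j) 0.
  by rewrite fz2// !mul0r.
by rewrite invfM mulrA mulfVK.
Qed.

Let weightl i j : weight (i, j) * p i = f i j / q j.
Proof.
rewrite /weight /=; have [pi0|pi0] := eqVneq (p i) 0.
  by rewrite fz1// !mul0r.
by rewrite mulrAC invfM mulrA mulfK.
Qed.

Lemma cell_measure_marginal1 A : measurable A ->
  cell_measure (A `*` setT) = P1 A.
Proof.
move=> mA; rewrite cell_measureE; last exact: measurableX.
have fA : P1 A \is a fin_num by exact: fin_num_measure.
rewrite -[RHS]fineK//; congr EFin.
have -> : fine (P1 A) = fine (P1 (A `&` [set w | predT (c1 w)])).
  by congr (fine (P1 _)); apply/seteqP; split => // x [].
rewrite -(prob_cells _ mc1)// sum_pair; apply: eq_bigr => i _.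
under eq_bigr => j _.
  rewrite /cell /= -setXI setTI PPX//; last exact: measurableI.
  rewrite -/(q j) mulrCA weightr; over.
rewrite /= -mulr_sumr -mulr_suml fp.
have [pi0|pi0] := eqVneq (p i) 0; last by rewrite divff// mulr1.
(* On a null cell both sides are 0, the right one by monotonicity. *)
rewrite pi0 mul0r mulr0; apply/esym/eqP; rewrite eq_le fine_ge0// andbT.
rewrite -pi0 fine_le ?fin_num_measure//; [exact: measurableI|].
by apply: le_measure; rewrite ?inE//; exact: measurableI.
Qed.

Lemma cell_measure_marginal2 B : measurable B ->
  cell_measure (setT `*` B) = P2 B.
Proof.
move=> mB; rewrite cell_measureE; last exact: measurableX.
have fB : P2 B \is a fin_num by exact: fin_num_measure.
rewrite -[RHS]fineK//; congr EFin.
have -> : fine (P2 B) = fine (P2 (B `&` [set w | predT (c2 w)])).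
  by congr (fine (P2 _)); apply/seteqP; split => // x [].
rewrite -(prob_cells _ mc2)// sum_pair exchange_big; apply: eq_bigr => j _ /=.
under eq_bigr => i _.
  rewrite /cell /= -setXI setTI PPX//; last exact: measurableI.
  rewrite -/(p i) mulrA weightl; over.
rewrite /= -!mulr_suml fq.
have [qj0|qj0] := eqVneq (q j) 0; last by rewrite divff// mul1r.
rewrite qj0 !mul0r; apply/esym/eqP; rewrite eq_le fine_ge0// andbT.
rewrite -qj0 fine_le ?fin_num_measure//; [exact: measurableI|].
by apply: le_measure; rewrite ?inE//; exact: measurableI.
Qed.

Let cell_measure_setT : cell_measure setT = 1%E.
Proof. by rewrite -setXTT cell_measure_marginal1// probability_setT. Qed.

HB.instance Definition _ :=
  Measure_isProbability.Build _ _ R cell_measure cell_measure_setT.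

Definition cell_prob : probability (T1 * T2)%type R := cell_measure.

Lemma cell_prob_cell i j : cell_prob (cell (i, j)) = (f i j)%:E.
Proof.
rewrite /cell_prob /= cell_measureE//; congr EFin.
rewrite (bigD1 (i, j))//= [X in _ + X]big1 ?addr0.
  rewrite setIid /cell /= PPX// -/(p i) -/(q j) mulrA weightl.
  have [qj0|qj0] := eqVneq (q j) 0; last by rewrite mulfVK.
  by rewrite fz2// !mul0r.
move=> z zij.
have -> : cell (i, j) `&` cell z = set0; last by rewrite measure0 mulr0.
rewrite -subset0 => -[x y] [[/= a1 a2] [/= e1 e2]].
by move: zij; rewrite (surjective_pairing z) -e1 -e2 a1 a2 eqxx.
Qed.

Lemma cell_prob_pairs (D : rel I) :
  cell_prob [set w | D (c1 w.1) (c2 w.2)] = (\sum_i \sum_(j | D i j) f i j)%:E.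
Proof.
pose c (w : T1 * T2) := (c1 w.1, c2 w.2).
have cE z : c @^-1` [set z] = cell z.
  apply/seteqP; split => -[x y]; rewrite /c /cell /=.
    by move=> <-.
  by move=> [-> ->]; rewrite -surjective_pairing.
have mc z : measurable (c @^-1` [set z]) by rewrite cE.
have := prob_cells cell_prob mc (fun z => D z.1 z.2) measurableT.
rewrite setTI => E.
have mD : measurable [set w | D (c1 w.1) (c2 w.2)].
  exact: (measurable_cells cell_prob mc (fun z => D z.1 z.2)).
rewrite -[LHS]fineK; last exact: fin_num_measure.
congr EFin; rewrite -[LHS]E.
have fE z : fine (cell_prob (setT `&` c @^-1` [set z])) = f z.1 z.2.
  by rewrite setTI cE; case: z => i j; rewrite cell_prob_cell.
under eq_bigr do rewrite fE.
by rewrite /= big_mkcond sum_pair; apply: eq_bigr => i _; rewrite [RHS]big_mkcond.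
Qed.

End cell_coupling.

(** * Quantization and couplings from separation *)

Section quantization.
Context (R : realType) (n k : nat).

Lemma lipschitz_pseudo_lipschitz (r : R) (psi : 'M[R]_(n, k) -> R) :
  (forall A B, `|psi A - psi B| <= nfrob (A - B)) -> pseudo_lipschitz r psi.
Proof.
move=> h A B; apply: le_trans (h A B) _; rewrite ler_peMr ?nfrob_ge0//.
by rewrite -addrA lerDl addr_ge0 ?powR_ge0.
Qed.

Lemma nfrob_lipschitz (A B : 'M[R]_(n, k)) :
  `|nfrob A - nfrob B| <= nfrob (A - B).
Proof.
have := nfrobD (A - B) B; have := nfrobD (B - A) A.
rewrite !subrK (nfrobB_sym B A) => ? ?.
by rewrite ler_norml; apply/andP; split; lra.
Qed.

Definition inbox (M : R) (A : 'M[R]_(n, k)) : bool :=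
  [forall z : 'I_n * 'I_k, `|A z.1 z.2| <= M].

Lemma mx_borel_entries (B : 'I_n * 'I_k -> set R) : (forall z, measurable (B z)) ->
  mx_borel [set A : 'M[R]_(n, k) | forall z, B z (A z.1 z.2)].
Proof.
move=> mB.
have -> : [set A : 'M[R]_(n, k) | forall z, B z (A z.1 z.2)] =
    \bigcap_(z in [set: 'I_n * 'I_k])
      ((fun A : 'M[R]_(n, k) => A z.1 z.2) @^-1` B z).
  by apply/seteqP; split => A h z; [move=> _; exact: h | exact: h].
apply: (@fin_bigcap_measurable _ (g_sigma_algebraType (@mx_gen R n k))).
  exact: finite_finset.
by move=> z _; apply: sub_sigma_algebra; exists z.1, z.2, (B z).
Qed.

Let mball (M : R) : measurable [set x : R | `|x| <= M].
Proof.
rewrite -[X in measurable X]setTI; apply: measurable_fun_ler => //.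
Qed.

Lemma mx_borel_inbox M : mx_borel [set A | inbox M A].
Proof.
have -> : [set A | inbox M A] =
    [set A : 'M[R]_(n, k) | forall z : 'I_n * 'I_k, `|A z.1 z.2| <= M].
  by apply/seteqP; split => A /forallP.
exact: (mx_borel_entries (fun=> mball M)).
Qed.

Lemma random_mx_tight (d : measure_display) (T : measurableType d)
    (P : probability T R) (V : T -> 'M[R]_(n, k)) (e : R) : random_mx V -> 0 < e ->
  exists N, forall m, (N <= m)%N -> fine (P [set w | ~~ inbox m%:R (V w)]) <= e.
Proof.
move=> mV e0.
have mA m : measurable [set w | ~~ inbox m%:R (V w)].
  have := measurableC (measurable_random_mx mV (mx_borel_inbox m%:R)).
  by congr (measurable _); apply/seteqP; split => w /= /negP.
have [] := @bounded_cvg _ _ _ P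
  (fun m => \1_[set w | ~~ inbox m%:R (V w)]) (fun=> 0) 1.
- by move=> m; exact: measurable_indic.
- by move=> m x; rewrite indicE; case: (_ \in _); rewrite ?normr1 ?normr0.
- move=> w; apply: cvg_near_cst; near=> m; rewrite indicE memNset//=; apply/negP; rewrite negbK.
  apply/forallP => z.
  apply: (@le_trans _ _ (\sum_(z : 'I_n * 'I_k) `|V w z.1 z.2|)).
    by rewrite (bigD1 z)//= lerDl sumr_ge0.
  by apply: ltW; near: m; exact: nbhs_infty_gtr.
move=> _; rewrite Rintegral_prob_cst => /cvgrPdist_le/(_ e e0)[N _ NP].
exists N => m Nm; have := NP m Nm; rewrite /= sub0r normrN /Rintegral.
by rewrite integral_indic// setIT => /(le_trans (ler_norm _)).
Unshelve. all: by end_near. Qed.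

(** The cells are small cubes filling a large box; [o] is the complement of the box, which tightness
    makes unlikely under both laws. *)
Lemma quantizer (d1 d2 : measure_display) (T1 : measurableType d1)
    (T2 : measurableType d2) (P1 : probability T1 R) (P2 : probability T2 R)
    (X : T1 -> 'M[R]_(n, k)) (Y : T2 -> 'M[R]_(n, k)) (rho e : R) :
  random_mx X -> random_mx Y -> 0 < rho -> 0 < e ->
  exists (I : finType) (o : I) (c : 'M[R]_(n, k) -> I),
  [/\ forall i, mx_borel (c @^-1` [set i]),
      forall x y, c x = c y -> c x != o -> nfrob (x - y) <= rho,
      fine (P1 [set w | c (X w) == o]) <= e
    & fine (P2 [set w | c (Y w) == o]) <= e].
Proof.
move=> mX mY rho0 e0.
have [N1 N1P] := random_mx_tight P1 mX e0.
have [N2 N2P] := random_mx_tight P2 mY e0.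
pose M : R := (maxn N1 N2)%:R.
(* Entries differing by at most [s] give [nfrob] at most s sqrt k, below [rho]. The added 1 keeps
   the divisor positive for k = 0. *)
pose s := rho / (Num.sqrt k%:R + 1).
have k0 : 0 < Num.sqrt k%:R + 1 :> R by rewrite ltr_wpDl ?sqrtr_ge0.
have s0 : 0 < s by rewrite divr_gt0.
pose g (x : R) := Num.truncn ((x + M) / s).
pose m := Num.truncn ((M + M) / s).
have ge0 x : `|x| <= M -> 0 <= (x + M) / s.
  by rewrite ler_norml => /andP[? ?]; rewrite divr_ge0 ?(ltW s0)//; lra.
have gm x : `|x| <= M -> (g x <= m)%N.
  rewrite ler_norml => /andP[_ xM]; apply: le_truncn.
  by rewrite ler_pM2r ?invr_gt0// lerD2r.
pose F (A : 'M[R]_(n, k)) : {ffun 'I_n * 'I_k -> 'I_m.+1} :=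
  [ffun z => inord (g (A z.1 z.2))].
pose c A := if inbox M A then Some (F A) else None.
have mg : measurable_fun setT (fun x : R => (g x)%:R : R).
  apply: nondecreasing_measurable => // x y xy; rewrite ler_nat.
  by apply: le_truncn; rewrite ler_pM2r ?invr_gt0// lerD2r.
have cN A : (c A == None) = ~~ inbox M A by rewrite /c; case: ifP.
exists (option {ffun 'I_n * 'I_k -> 'I_m.+1}), None, c; split.
- move=> [phi|].
    have -> : c @^-1` [set Some phi] = [set A | forall z : 'I_n * 'I_k,
        ([set x : R | `|x| <= M] `&`
         (fun x : R => (g x)%:R : R) @^-1` [set (phi z : nat)%:R]) (A z.1 z.2)].
      apply/seteqP; split => A /=; rewrite /c.
        case: ifPn => // /forallP bA [<-] z; split; first exact: bA.
        by rewrite /= ffunE inordK// ltnS; exact: gm.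
      move=> h; have bA : inbox M A by apply/forallP => z; case: (h z).
      rewrite bA; congr Some; apply/ffunP => z; rewrite ffunE.
      have [_ /= /eqP] := h z; rewrite eqr_nat => /eqP ->.
      exact: inord_val.
    apply: (mx_borel_entries (B := fun z => [set x : R | `|x| <= M] `&`
      (fun x : R => (g x)%:R : R) @^-1` [set (phi z : nat)%:R])) => z.
    apply: measurableI; first exact: mball.
    by rewrite -[X in measurable X]setTI; exact: mg.
  have -> : c @^-1` [set None] = ~` [set A | inbox M A].
    apply/seteqP; split => A /= h; first by apply/negP; rewrite -cN h.
    by apply/eqP; rewrite cN; exact/negP.
  exact: (@measurableC _ (g_sigma_algebraType (@mx_gen R n k)) _
    (mx_borel_inbox M)).
- move=> x y cxy; rewrite cN negbK => bx.
  have /eqP := cxy; rewrite /c bx; case: ifPn => // by_ /eqP[/ffunP Fxy].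
  apply: (@le_trans _ _ (s * Num.sqrt k%:R)); last first.
    by rewrite /s mulrAC ler_pdivrMr// ler_pM2l// lerDl.
  apply: nfrob_le_entries; first exact: ltW.
  move=> i j; rewrite !mxE.
  have bx' := forallP bx (i, j); have by' := forallP by_ (i, j).
  have /(congr1 val) := Fxy (i, j).
  rewrite !ffunE /= !inordK ?ltnS ?gm// => gxy.
  have /andP[l1 u1] := truncn_itv (ge0 _ bx').
  have /andP[l2 u2] := truncn_itv (ge0 _ by').
  rewrite -/(g _) /= in l1 u1; rewrite -/(g _) /= -gxy in l2 u2.
  rewrite -(ler_pM2r (_ : 0 < s^-1)) ?invr_gt0// divff ?gt_eqF//.
  rewrite -[s^-1]ger0_norm ?invr_ge0 ?(ltW s0)// -normrM.
  rewrite -natr1 in u1 u2; rewrite ler_norml mulrBl.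
  move: l1 u1 l2 u2; rewrite !mulrDl => ? ? ? ?.
  by apply/andP; split; lra.
- under [X in P1 X]eq_set do rewrite cN.
  exact: N1P (leq_maxl _ _).
- under [X in P2 X]eq_set do rewrite cN.
  exact: N2P (leq_maxr _ _).
Qed.

End quantization.

(** Cells are close when they contain points within [e]. Unmatched mass above 2 e would give two
    sets of cells without close pairs, both of probability at least [e], against the separation
    hypothesis. *)
Lemma coupling_of_separation (R : realType) (n k : nat) (d1 d2 : measure_display)
    (T1 : measurableType d1) (T2 : measurableType d2)
    (P1 : probability T1 R) (P2 : probability T2 R)
    (X : T1 -> 'M[R]_(n, k)) (Y : T2 -> 'M[R]_(n, k)) (e : R) :
  (0 < n)%N -> random_mx X -> random_mx Y -> 0 < e ->
  (forall A B, mx_borel A -> mx_borel B -> (e%:E <= P1 (X @^-1` A))%E ->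
    (e%:E <= P2 (Y @^-1` B))%E ->
    exists x y, [/\ A x, B y & nfrob (x - y) <= e]) ->
  exists PC : probability (T1 * T2)%type R,
  [/\ forall A, measurable A -> PC (A `*` setT) = P1 A,
      forall B, measurable B -> PC (setT `*` B) = P2 B
    & (PC [set w | (2 * e < nfrob (X w.1 - Y w.2))%R] <= (2 * e)%:E)%E].
Proof.
move=> n0 mX mY e0 sep.
(* Two cell diameters e / 2 and a gap [e] add up to 2 e. *)
have e20 : 0 < e / 2 by rewrite divr_gt0.
have [I [ o [c [mc cclose o1 o2]]]] := quantizer P1 P2 mX mY e20 e0.
have mc1 i : measurable ((c \o X) @^-1` [set i]).
  exact: (measurable_random_mx mX (mc i)).
have mc2 i : measurable ((c \o Y) @^-1` [set i]).
  exact: (measurable_random_mx mY (mc i)).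
pose p i := fine (P1 ((c \o X) @^-1` [set i])).
pose q i := fine (P2 ((c \o Y) @^-1` [set i])).
pose close i j := `[< exists x y, [/\ c x = i, c y = j, i != o, j != o
  & nfrob (x - y) <= e] >].
have total (d : measure_display) (T : measurableType d) (P : probability T R)
    (c' : T -> I) : (forall i, measurable (c' @^-1` [set i])) ->
    \sum_i fine (P (c' @^-1` [set i])) = 1.
  move=> mc'; have := prob_cells P mc' predT measurableT.
  under eq_bigr do rewrite setTI.
  rewrite setTI => ->.
  by have -> : [set w | predT (c' w)] = setT; [apply/seteqP|rewrite probability_setT].
have [f [A [B [[f0 fp fq] AB mA mB]]]] := @finite_coupling R I p q close
  (fun i => fine_ge0 (measure_ge0 _ _)) (fun i => fine_ge0 (measure_ge0 _ _))
  (total _ _ P1 _ mc1) (total _ _ P2 _ mc2).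
set m := \sum_i _ in mA mB.
have m2e : m <= 2 * e.
  rewrite leNgt; apply/negP => em.
  (* Discarding the outer cell costs at most [e] of the mass above 2 e. *)
  have key (d : measure_display) (T : measurableType d) (P : probability T R)
      (V : T -> 'M[R]_(n, k)) (D : {set I}) : random_mx V ->
      fine (P [set w | c (V w) == o]) <= e ->
      m <= \sum_(i in D) fine (P ((c \o V) @^-1` [set i])) ->
      mx_borel [set x | (c x \in D) && (c x != o)] /\
      (e%:E <= P (V @^-1` [set x | (c x \in D) && (c x != o)]))%E.
    move=> mV Po mD.
    have mcV i : measurable ((c \o V) @^-1` [set i]).
      exact: (measurable_random_mx mV (mc i)).
    have bD : mx_borel [set x | (c x \in D) && (c x != o)].
      exact: (@measurable_cells R _ (g_sigma_algebraType (@mx_gen R n k))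
        (\d_(0 : g_sigma_algebraType (@mx_gen R n k))) I c mc
        (fun i => (i \in D) && (i != o))).
    split=> //.
    have fin : P (V @^-1` [set x | (c x \in D) && (c x != o)]) \is a fin_num.
      by rewrite fin_num_measure//; exact: (measurable_random_mx mV bD).
    rewrite -(fineK fin) lee_fin.
    have := prob_cells P mcV (fun i => (i \in D) && (i != o)) measurableT.
    rewrite setTI => E; rewrite -[leRHS]E.
    under eq_bigr do rewrite setTI.
    have : \sum_(i in D) fine (P ((c \o V) @^-1` [set i])) <=
        \sum_(i | (i \in D) && (i != o)) fine (P ((c \o V) @^-1` [set i])) +
        fine (P [set w | c (V w) == o]).
      have -> : [set w | c (V w) == o] = (c \o V) @^-1` [set o].
        by apply/seteqP; split => w /= /eqP.
      have [oD|oD] := boolP (o \in D).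
        by rewrite (bigD1 o)//= addrC lerD2r.
      rewrite -[leLHS]addr0 lerD ?fine_ge0//.
      rewrite le_eqVlt; apply/orP; left; apply/eqP; apply: eq_bigl => i.
      by case: eqP => [->|]; rewrite ?andbT// (negbTE oD).
    by lra.
  have [bA eA] := key _ _ P1 X A mX o1 mA.
  have [bB eB] := key _ _ P2 Y B mY o2 mB.
  have [x [y [/andP[xA xo] /andP[yB yo] xy]]] := sep _ _ bA bB eA eB.
  by have /negP := AB _ _ xA yB; apply; apply/asboolP; exists x, y.
exists (cell_prob o mc1 mc2 f0 fp fq); split.
- by move=> A'; exact: cell_measure_marginal1.
- by move=> B'; exact: cell_measure_marginal2.
have mE : measurable [set w : T1 * T2 | 2 * e < nfrob (X w.1 - Y w.2)].
  have mXY : random_mx (fun w : T1 * T2 => X w.1 - Y w.2).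
    move=> i j; under eq_fun do rewrite !mxE.
    apply: measurable_funB.
      exact: (measurableT_comp (mX i j) measurable_fst).
    exact: (measurableT_comp (mY i j) measurable_snd).
  have := measurable_random_mx mXY (mx_borel_preimage n0 (lexx 1)
    (lipschitz_pseudo_lipschitz 1 (@nfrob_lipschitz R n k))
    (measurable_itv `]2 * e, +oo[)).
  congr (measurable _).
  by apply/seteqP; split => w /=; rewrite in_itv/= andbT.
apply: (@le_trans _ _ (cell_prob o mc1 mc2 f0 fp fq
    [set w | ~~ close ((c \o X) w.1) ((c \o Y) w.2)])).
  apply: le_measure; rewrite ?inE//.
    pose c' (w : T1 * T2) := (c (X w.1), c (Y w.2)).
    have mc' z : measurable (c' @^-1` [set z]).
      have -> : c' @^-1` [set z] =
          ((c \o X) @^-1` [set z.1]) `*` ((c \o Y) @^-1` [set z.2]).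
        apply/seteqP; split => -[a b]; rewrite /c' /=; first by move=> <-.
        by move=> [-> ->]; rewrite -surjective_pairing.
      exact: measurableX.
    exact: (measurable_cells (P1 \x P2)%E mc' (fun z => ~~ close z.1 z.2)).
  move=> [a b] /= far; apply/negP => /asboolP[x [y [cx cy xo yo xy]]].
  have h1 : nfrob (X a - x) <= e / 2 by apply: cclose; rewrite -cx// cx.
  have h2 : nfrob (y - Y b) <= e / 2 by apply: cclose => //; rewrite cy.
  have := nfrobD (X a - x) (x - Y b); have := nfrobD (x - y) (y - Y b).
  by rewrite !subrKA; lra.
by rewrite (cell_prob_pairs _ _ _ _ _ _ (fun i j => ~~ close i j)) lee_fin.
Qed.

Lemma diag_le_opnorm (R : realType) (k : nat) (S : 'M[R]_k) (C : R) :
  (forall v : 'cV[R]_k, vnorm (S *m v) <= C * vnorm v) -> forall j, S j j <= C.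
Proof.
move=> SC j; have := SC (delta_mx j 0).
have -> : vnorm (delta_mx j 0 : 'cV[R]_k) = 1.
  rewrite /vnorm (bigD1 j)//= big1 ?addr0; last first.
    by move=> i /negbTE ij; rewrite mxE ij expr0n.
  by rewrite mxE !eqxx expr1n sqrtr1.
rewrite mulr1; apply: le_trans; apply: le_trans (ler_norm _) _.
rewrite -sqrtr_sqr /vnorm ler_sqrt; last by apply: sumr_ge0 => *; exact: sqr_ge0.
rewrite -colE (bigD1 j)//= mxE lerDl.
by apply: sumr_ge0 => *; exact: sqr_ge0.
Qed.

Lemma gaussian_nfrob_tight (R : realType) (k : nat) (C eta : R) : 0 < eta ->
  exists2 M : R, 0 <= M & forall n, (0 < n)%N ->
  forall (d : measure_display) (T : measurableType d) (P : probability T R)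
    (S : 'M[R]_k) (Y : T -> 'M[R]_(n, k)),
  psd S -> (forall j, S j j <= C) -> gaussian_mx P S Y ->
  (P [set w | (M < nfrob (Y w))%R] <= eta%:E)%E.
Proof.
move=> eta0.
pose D := k%:R * moment_bound C 2.
have D0 : 0 <= D by rewrite /D /moment_bound !mulr_ge0 ?exprn_ge0 ?expR_ge0.
(* M >= 1 and M >= D / eta together give D / M^2 <= eta. *)
pose M := 1 + D / eta.
have M1 : 1 <= M by rewrite lerDl divr_ge0// ltW.
have M0 : 0 < M by exact: lt_le_trans M1.
exists M; first exact: ltW.
move=> n n0 d T P S Y psdS SC gY.
have nR0 : 0 < n%:R :> R by rewrite ltr0n.
have [iG sG] := gaussian_moment_sum psdS gY SC (isT : (0 < 2)%N).
pose Z w := n%:R^-1 * \sum_i \sum_j `|Y w i j| ^+ 2.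
have ZE w : Z w = nfrob (Y w) ^+ 2.
  rewrite sqr_nfrob /Z mulrC; congr (_ / _).
  apply: eq_bigr => i _; apply: eq_bigr => j _.
  by rewrite real_normK// num_real.
have iZ : P.-integrable setT (EFin \o Z).
  have := integrableZl measurableT n%:R^-1 iG.
  exact: eq_integrable.
have M20 : 0 < M ^+ 2 by rewrite exprn_gt0.
have -> : [set w | M < nfrob (Y w)] = [set w | M ^+ 2 < `|Z w|].
  apply/seteqP; split => w /=; rewrite ZE ger0_norm ?sqr_ge0//;
    by rewrite ltr_sqr ?nnegrE ?nfrob_ge0 ?(ltW M0).
apply: le_trans (markov_Rintegral M20 iZ) _; rewrite lee_fin.
have -> : \int[P]_w `|Z w| = \int[P]_w Z w.
  by apply: eq_Rintegral => w _; rewrite ger0_norm// ZE sqr_ge0.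
have ZD : \int[P]_w Z w <= D.
  rewrite RintegralZl// mulrC ler_pdivrMr//; apply: le_trans sG _.
  by rewrite le_eqVlt; apply/orP; left; apply/eqP; rewrite /D; ring.
rewrite mulrC ler_pdivrMr//; apply: le_trans ZD _.
have : D <= eta * M by rewrite /M mulrDr mulr1 mulrC divfK ?gt_eqF// lerDr ltW.
move=> /le_trans; apply; rewrite ler_pM2l// expr2 ler_peMl// ltW//.
Qed.

(** * The two implications *)

Section main.
Context (R : realType) (d : nat).
Context (dX : nat -> measure_display) (TX : forall n, measurableType (dX n))
  (PX : forall n, probability (TX n) R)
  (X : forall n, TX n -> 'M[R]_(n, d))
  (dY : nat -> measure_display) (TY : forall n, measurableType (dY n))
  (PY : forall n, probability (TY n) R)
  (Y : forall n, TY n -> 'M[R]_(n, d))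
  (Sigma : nat -> 'M[R]_d) (C : R).
Arguments X : clear implicits.
Arguments Y : clear implicits.
Hypotheses (mX : forall n, random_mx (X n)) (psdS : forall n, psd (Sigma n))
  (SC : forall n j, Sigma n j j <= C)
  (gY : forall n, gaussian_mx (PY n) (Sigma n) (Y n)).
Arguments mX : clear implicits.

(** Outside three events of probability at most eta / 4 each (coupled matrices far apart, [Y']
    large, [psi n] at [Y'] far from its mean), the deviation at [X'] is at most [e]. *)
Lemma pseudo_lipschitz_cvg_of_coupling
    (dC : nat -> measure_display) (TC : forall n, measurableType (dC n))
    (PC : forall n, probability (TC n) R)
    (X' Y' : forall n, TC n -> 'M[R]_(n, d)) (r : R)
    (psi : forall n, 'M[R]_(n, d) -> R) :
  (forall n, random_mx (X' n) /\ random_mx (Y' n) /\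
     same_law (PC n) (PX n) (X' n) (X n) /\
     same_law (PC n) (PY n) (Y' n) (Y n)) ->
  cvg_prob0 PC (fun n w => nfrob (X' n w - Y' n w)) ->
  1 <= r -> (forall n, pseudo_lipschitz r (psi n)) ->
  cvg_prob0 PX (fun n w => `|psi n (X n w) - \int[PY n]_w psi n (Y n w)|).
Proof.
move=> cpl cvC r1 lpsi e e0; apply/cvge0P => // eta eta0.
have eta4 : 0 < eta / 4 by rewrite divr_gt0.
have [M M0 tight] := @gaussian_nfrob_tight R d C _ eta4.
(* Growth factor when the norms of [X'] and [Y'] are at most M + 1 and M; the extra 1 is why [del]
   is capped at 1. *)
pose L := 1 + (M + 1) `^ (r - 1) + M `^ (r - 1).
have L0 : 0 < L by rewrite /L -addrA ltr_pwDl// addr_ge0 ?powR_ge0.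
pose del := Num.min 1 (e / 2 / L).
have del0 : 0 < del by rewrite lt_min ltr01 !divr_gt0.
have del1 : del <= 1 by rewrite ge_min lexx.
have delL : del * L <= e / 2 by rewrite -ler_pdivlMr// ge_min lexx orbT.
have [N1 N1P] := (cvge0P (fun n => measure_ge0 _ _)).1 (cvC _ del0) _ eta4.
(* An L1 bound of this size becomes probability eta / 4 at level e / 2 by Markov. *)
have ee : 0 < e / 2 * (eta / 4) by rewrite mulr_gt0// divr_gt0.
have [N2 N2P] := @gaussian_concentration R d C r _ r1 ee.
exists (maxn 1 (maxn N1 N2)) => n; rewrite !geq_max => /and3P[n0 n1 n2].
have [mX' [mY' [lawX lawY]]] := cpl n.
have [iY cY] := N2P n n2 _ _ (PY n) (Sigma n) (Y n) (psi n) (psdS n) (SC n)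
  (gY n) (lpsi n).
set c := \int[PY n]_w psi n (Y n w) in cY *.
have bpsi a : mx_borel [set A | a < `|psi n A - c|].
  have := mx_borel_preimage n0 r1 (lpsi n) (B := [set y | a < `|y - c|]).
  apply; rewrite -[X in measurable X]setTI; apply: measurable_fun_ltr => //.
  by apply: measurableT_comp => //; exact: measurable_funB.
have bnf a : mx_borel [set A : 'M[R]_(n, d) | a < nfrob A].
  have := mx_borel_preimage n0 (lexx 1)
    (lipschitz_pseudo_lipschitz 1 (@nfrob_lipschitz R n d))
    (B := [set y | a < y]).
  apply; rewrite -[X in measurable X]setTI; exact: measurable_fun_ltr.
have -> : [set w | e < `| `|psi n (X n w) - c| |] =
    X n @^-1` [set A | e < `|psi n A - c|].
  by apply/seteqP; split => w /=; rewrite normr_id.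
rewrite -(lawX _ (bpsi e)).
pose E1 := [set w | del < `|nfrob (X' n w - Y' n w)|].
pose E2 := Y' n @^-1` [set A | M < nfrob A].
pose E3 := Y' n @^-1` [set A | e / 2 < `|psi n A - c|].
have mE1 : measurable E1.
  have mXY : random_mx (fun w => X' n w - Y' n w).
    move=> i j; under eq_fun do rewrite !mxE.
    by apply: measurable_funB; [exact: mX' | exact: mY'].
  have := measurable_random_mx mXY (bnf del).
  congr (measurable _); apply/seteqP.
  by split => w; rewrite /E1 /= ger0_norm// nfrob_ge0.
have mE2 : measurable E2 := measurable_random_mx mY' (bnf M).
have mE3 : measurable E3 := measurable_random_mx mY' (bpsi (e / 2)).
apply: (@le_trans _ _ (PC n (E1 `|` E2 `|` E3))).
  apply: le_measure; rewrite ?inE.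
  - exact: (measurable_random_mx mX' (bpsi e)).
  - by apply: measurableU => //; exact: measurableU.
  move=> w /= eX.
  have [h1|h1] := ltP del `|nfrob (X' n w - Y' n w)|; first by left; left.
  have [h2|h2] := ltP M (nfrob (Y' n w)); first by left; right.
  right; rewrite /E3 /=; move: h1; rewrite ger0_norm ?nfrob_ge0// => h1.
  have xM : nfrob (X' n w) <= M + 1.
    have := nfrobD (X' n w - Y' n w) (Y' n w); rewrite subrK; lra.
  have b : `|psi n (X' n w) - psi n (Y' n w)| <= e / 2.
    apply: le_trans (lpsi n _ _) _; apply: le_trans delL.
    apply: ler_pM => //; first exact: nfrob_ge0.
      by rewrite -addrA addr_ge0// addr_ge0 ?powR_ge0.
    have := ler_powR_nfrob r1 (nfrob_ge0 _) xM.
    have := ler_powR_nfrob r1 (nfrob_ge0 _) h2.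
    by rewrite /L; lra.
  have := ler_distD (psi n (Y' n w)) (psi n (X' n w)) c; lra.
apply: le_trans (measureU2 _ _ _) _ => //; first exact: measurableU.
have p3 : (PC n E3 <= (eta / 4)%:E)%E.
  rewrite [leLHS](lawY _ (bpsi (e / 2))).
  have iZ : (PY n).-integrable setT (EFin \o (fun w => psi n (Y n w) - c)).
    have := integrableB measurableT iY
      (bmeas_integrable (PY n) (@bmeas_cst _ _ (TY n) c)).
    exact: eq_integrable.
  have e2 : 0 < e / 2 by rewrite divr_gt0.
  apply: le_trans (markov_Rintegral e2 iZ) _; rewrite lee_fin.
  by rewrite mulrC ler_pdivrMr// mulrC.
have p2 : (PC n E2 <= (eta / 4)%:E)%E.
  by rewrite [leLHS](lawY _ (bnf M)); exact: tight (psdS n) (SC n) (gY n).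
have p1 : (PC n E1 <= (eta / 4)%:E)%E by exact: N1P.
apply: (@le_trans _ _ ((eta / 4)%:E + (eta / 4)%:E + (eta / 4)%:E)%E).
  apply: leeD => //; apply: le_trans (measureU2 _ _ _) _ => //.
  exact: leeD.
by rewrite -!EFinD lee_fin; lra.
Qed.

Let sep n (e : R) := forall A B, mx_borel A -> mx_borel B ->
  (e%:E <= PX n (X n @^-1` A))%E -> (e%:E <= PY n (Y n @^-1` B))%E ->
  exists x y, [/\ A x, B y & nfrob (x - y) <= e].

Let dist n (B : set 'M[R]_(n, d)) (x : 'M[R]_(n, d)) : R :=
  inf [set nfrob (x - y) | y in B].

Let dist_lip n (B : set 'M[R]_(n, d)) x x' :
  `|dist B x - dist B x'| <= nfrob (x - x').
Proof.
have half z z' : dist B z <= dist B z' + nfrob (z - z').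
  (* The infimum of the empty set is 0 by convention, so the Lipschitz bound survives. *)
  have [->|/set0P[y0 By0]] := eqVneq B set0.
    by rewrite /dist !image_set0 inf0 add0r nfrob_ge0.
  rewrite -lerBlDr; apply: lb_le_inf; first by exists (nfrob (z' - y0)), y0.
  move=> _ [y By <-]; rewrite lerBlDr.
  apply: (@le_trans _ _ (nfrob (z - y))).
    apply: ge_inf; last by exists y.
    by exists 0 => _ [y' _ <-]; exact: nfrob_ge0.
  by have := nfrobD (z - z') (z' - y); rewrite subrKA; lra.
have := half x x'; have := half x' x; rewrite (nfrobB_sym x' x) => ? ?.
by rewrite ler_norml; apply/andP; split; lra.
Qed.

Hypothesis cvX : forall psi : forall n, 'M[R]_(n, d) -> R,
  (forall n, pseudo_lipschitz 1 (psi n)) ->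
  cvg_prob0 PX (fun n w => `|psi n (X n w) - \int[PY n]_w psi n (Y n w)|).

(* The distance to a set of non-negligible probability under [Y n] concentrates
   around [0] for [Y n], hence is small for [X n] with high probability. *)
Lemma eventually_separation (e : R) : 0 < e ->
  exists N, forall n, (N <= n)%N -> sep n e.
Proof.
move=> e0.
(* [cvX] concerns a whole sequence of functions, so a counterexample is selected for every [n] at
   once, arbitrary where none exists. *)
pose bad n (B : set 'M[R]_(n, d)) := mx_borel B /\
  (e%:E <= PY n (Y n @^-1` B))%E /\ exists A, [/\ mx_borel A,
  (e%:E <= PX n (X n @^-1` A))%E & forall x y, A x -> B y -> e < nfrob (x - y)].
have H n : exists B : set 'M[R]_(n, d), (exists B, bad n B) -> bad n B.
  have [[B bB]|nb] := pselect (exists B, bad n B); first by exists B.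
  by exists set0.
pose b n := sval (cid (H n)).
have bP n : (exists B, bad n B) -> bad n (b n) := svalP (cid (H n)).
pose psi n := dist (b n).
have lpsi n r : pseudo_lipschitz r (psi n).
  exact: lipschitz_pseudo_lipschitz (@dist_lip n (b n)).
have e2 : 0 < e / 2 by rewrite divr_gt0.
have e4 : 0 < e / 4 by rewrite divr_gt0.
have ee : 0 < e / 4 * (e / 2) by rewrite mulr_gt0.
have [N1 N1P] := (cvge0P (fun n => measure_ge0 _ _)).1
  (cvX (fun n => lpsi n 1) e2) _ e2.
have [N2 N2P] := @gaussian_concentration R d C 1 _ (lexx 1) ee.
exists (maxn 1 (maxn N1 N2)) => n; rewrite !geq_max => /and3P[n0 n1 n2].
move=> A B mA mB pA pB; apply: contrapT => far.
have [|mb [pb [A' [mA' pA' farA']]]] := bP n.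
  exists B; split=> //; split=> //; exists A; split=> // x y Ax By.
  by rewrite ltNge; apply/negP => xy; apply: far; exists x, y.
have [iY cY] := N2P n n2 _ _ (PY n) (Sigma n) (Y n) (psi n) (psdS n) (SC n)
  (gY n) (lpsi n 1).
set c := \int[PY n]_w psi n (Y n w) in cY.
have [y0 By0] : b n !=set0.
  apply/set0P; apply: contraTneq pb => ->.
  by rewrite preimage_set0 measure0 -ltNge lte_fin.
have nf_lb x : has_lbound [set nfrob (x - y) | y in b n].
  by exists 0 => _ [y' _ <-]; exact: nfrob_ge0.
have mpsi (a : R) : mx_borel [set x | a < `|psi n x - c|].
  have := mx_borel_preimage n0 (lexx 1) (lpsi n 1) (B := [set y | a < `|y - c|]).
  apply; rewrite -[X in measurable X]setTI; apply: measurable_fun_ltr => //.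
  by apply: measurableT_comp => //; exact: measurable_funB.
(* The distance vanishes on [b n], of probability at least [e], whereas it is farther than e / 4
   from [c] with probability at most e / 2. *)
have ce : `|c| <= e / 4.
  rewrite leNgt; apply/negP => ec.
  have iZ : (PY n).-integrable setT (EFin \o (fun w => psi n (Y n w) - c)).
    have := integrableB measurableT iY
      (bmeas_integrable (PY n) (@bmeas_cst _ _ (TY n) c)).
    exact: eq_integrable.
  have := markov_Rintegral e4 iZ; apply/negP; rewrite -ltNge.
  apply: (@lt_le_trans _ _ e%:E).
    rewrite lte_fin; apply: (@le_lt_trans _ _ (e / 2)); last by lra.
    by rewrite mulrC ler_pdivrMr// mulrC.
  apply: le_trans pb _; apply: le_measure; rewrite ?inE.
  - exact: (measurable_random_mx (gY n).1 mb).
  - exact: (measurable_random_mx (gY n).1 (mpsi (e / 4))).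
  move=> w /= bw.
  have -> : psi n (Y n w) = 0.
    apply/eqP; rewrite eq_le; apply/andP; split.
      apply: ge_inf => //; exists (Y n w) => //.
      by rewrite subrr /nfrob frob0 mul0r.
    apply: lb_le_inf; first by exists (nfrob (Y n w - y0)), y0.
    by move=> _ [y _ <-]; exact: nfrob_ge0.
  by rewrite sub0r normrN.
(* On [A'] the distance is at least [e], hence more than e / 2 away from [c], with probability at
   least [e]; this contradicts (ii). *)
have := N1P n n1; apply/negP; rewrite -ltNge.
apply: (@lt_le_trans _ _ e%:E); first by rewrite lte_fin; lra.
apply: le_trans pA' _; apply: le_measure; rewrite ?inE.
- exact: (measurable_random_mx (mX n) mA').
- have := measurable_random_mx (mX n) (mpsi (e / 2)).
  by congr (measurable _); apply/seteqP; split => w /=; rewrite normr_id.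
move=> w /= Aw; rewrite normr_id -/c.
have psie : e <= psi n (X n w).
  apply: lb_le_inf; first by exists (nfrob (X n w - y0)), y0.
  by move=> _ [y By <-]; apply: ltW; exact: farA'.
apply: lt_le_trans (ler_norm _).
by move: ce; rewrite ler_norml => /andP[? ?]; lra.
Qed.

Let measurable_far n (a : R) : (0 < n)%N ->
  measurable [set w : TX n * TY n | a < nfrob (X n w.1 - Y n w.2)].
Proof.
move=> n0; have mXY : random_mx (fun w : TX n * TY n => X n w.1 - Y n w.2).
  move=> i j; under eq_fun do rewrite !mxE.
  apply: measurable_funB.
    exact: (measurableT_comp (mX n i j) measurable_fst).
  exact: (measurableT_comp ((gY n).1 i j) measurable_snd).
have mI : measurable [set y : R | a < y].
  by rewrite -[X in measurable X]setTI; exact: measurable_fun_ltr.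
exact: (measurable_random_mx mXY (mx_borel_preimage n0 (lexx 1)
  (lipschitz_pseudo_lipschitz 1 (@nfrob_lipschitz R n d)) mI)).
Qed.

Let coupled n (e : R) (P : probability (TX n * TY n)%type R) :=
  [/\ forall A, measurable A -> P (A `*` setT) = PX n A,
      forall B, measurable B -> P (setT `*` B) = PY n B
    & (P [set w | (2 * e < nfrob (X n w.1 - Y n w.2))%R] <= (2 * e)%:E)%E].

(** At level 1 the bound 2 exceeds any probability, so the product law will do. For n = 0 the
    quotient by sqrt 0 is 0 and the event is empty. *)
Let coupled1 n : exists P, @coupled n 1 P.
Proof.
exists ((PX n \x PY n)%E : probability _ _); split.
- by move=> A mA; rewrite [LHS]product_measure1E// [X in (_ * X)%E]probability_setT mule1.
- by move=> B mB; rewrite [LHS]product_measure1E// [X in (X * _)%E]probability_setT mul1e.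
case: n => [|n].
  have -> : [set w : TX 0 * TY 0 | 2 * 1 < nfrob (X 0 w.1 - Y 0 w.2)] = set0.
    rewrite -subset0 => w /=.
    by rewrite /nfrob sqrtr0 invr0 mulr0 mulr1 ltNge ler0n.
  by rewrite measure0 lee_fin mulr1.
apply: le_trans (probability_le1 _ (measurable_far _ _)) _ => //.
by rewrite lee_fin; lra.
Qed.

(** Diagonal choice: at each [n] take the best level 1 / (j + 1) with j <= n that admits a coupling.
    Each fixed level is eventually reached, so the chosen one tends to 0. *)
Lemma coupling_exists :
  exists P : forall n, probability (TX n * TY n)%type R,
  (forall n, (forall A, measurable A -> P n (A `*` setT) = PX n A) /\
             (forall B, measurable B -> P n (setT `*` B) = PY n B)) /\
  cvg_prob0 P (fun n w => nfrob (X n w.1 - Y n w.2)).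
Proof.
(* The cap j <= n guarantees a maximal [j], and [coupled1] provides j = 0. *)
pose Q n j := (j <= n)%N && `[< exists P, @coupled n j.+1%:R^-1 P >].
have Q0 n : exists j, Q n j.
  exists 0%N; rewrite /Q /=; apply/asboolP.
  by rewrite invr1; exact: coupled1.
have Qn n j : Q n j -> (j <= n)%N by case/andP.
pose k n := ex_maxn (Q0 n) (Qn n).
have kQ n : Q n (k n) by rewrite /k; case: ex_maxnP.
have kmax n j : Q n j -> (j <= k n)%N.
  by rewrite /k; case: ex_maxnP => i _ h; exact: h.
have HP n : exists P, @coupled n (k n).+1%:R^-1 P.
  by have /andP[_ /asboolP] := kQ n.
pose P n := sval (cid (HP n)).
have PP n : coupled (k n).+1%:R^-1 (P n) := svalP (cid (HP n)).
exists P; split; first by move=> n; have [? ? _] := PP n.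
move=> e e0; apply/cvge0P => // eta eta0.
pose t := Num.min e eta / 2.
have t0 : 0 < t by rewrite divr_gt0// lt_min e0.
pose j := Num.truncn t^-1.
have j0 : 0 < j.+1%:R^-1 :> R by rewrite invr_gt0 ltr0n.
have jt : j.+1%:R^-1 <= t.
  rewrite -[leRHS]invrK lef_pV2 ?posrE ?invr_gt0 ?ltr0n//.
  exact/ltW/truncnS_gt.
have [N NP] := eventually_separation j0.
exists (maxn 1 (maxn N j)) => n; rewrite !geq_max => /and3P[n0 nN nj].
have jk : (j <= k n)%N.
  apply: kmax; rewrite /Q nj; apply/asboolP.
  exact: (coupling_of_separation n0 (mX n) (gY n).1 j0 (NP n nN)).
have kt : (k n).+1%:R^-1 <= t.
  apply: le_trans jt; rewrite lef_pV2 ?posrE ?ltr0n// ler_nat ltnS//.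
have te : 2 * t <= e by rewrite /t mulrC divfK// ge_min lexx.
have teta : 2 * t <= eta by rewrite /t mulrC divfK// ge_min lexx orbT.
have [_ _ far] := PP n.
apply: (@le_trans _ _ (2 * (k n).+1%:R^-1)%:E); last first.
  by rewrite lee_fin (le_trans _ teta)// ler_pM2l.
apply: le_trans far; apply: le_measure; rewrite ?inE.
- have := measurable_far e n0; congr (measurable _).
  by apply/seteqP; split => w /=; rewrite ger0_norm// nfrob_ge0.
- exact: measurable_far.
move=> w /=; rewrite ger0_norm ?nfrob_ge0//; apply: le_lt_trans.
by apply: le_trans te; rewrite ler_pM2l.
Qed.

End main.

Theorem theorem7 (R : realType) (d : nat)
  (dX : nat -> measure_display) (TX : forall n, measurableType (dX n))
  (PX : forall n, probability (TX n) R)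
  (X : forall n, TX n -> 'M[R]_(n, d))
  (dY : nat -> measure_display) (TY : forall n, measurableType (dY n))
  (PY : forall n, probability (TY n) R)
  (Y : forall n, TY n -> 'M[R]_(n, d))
  (Sigma : nat -> 'M[R]_d) :
  (forall n, random_mx (X n)) ->
  (forall n, psd (Sigma n)) ->
  (exists C : R, forall n (v : 'cV[R]_d), vnorm (Sigma n *m v) <= C * vnorm v) ->
  (forall n, gaussian_mx (PY n) (Sigma n) (Y n)) ->
  ((exists (dC : nat -> measure_display) (TC : forall n, measurableType (dC n))
           (PC : forall n, probability (TC n) R)
           (X' Y' : forall n, TC n -> 'M[R]_(n, d)),
       (forall n, random_mx (X' n) /\ random_mx (Y' n) /\
                  same_law (PC n) (PX n) (X' n) (X n) /\
                  same_law (PC n) (PY n) (Y' n) (Y n)) /\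
       cvg_prob0 PC (fun n w => frob (X' n w - Y' n w) / Num.sqrt n%:R))
   <->
   (forall r : R, 1 <= r ->
    forall psi : forall n, 'M[R]_(n, d) -> R,
      (forall n (A B : 'M[R]_(n, d)),
         `|psi n A - psi n B|
           <= frob (A - B) / Num.sqrt n%:R
              * (1 + (frob A / Num.sqrt n%:R) `^ (r - 1)
                   + (frob B / Num.sqrt n%:R) `^ (r - 1))) ->
      cvg_prob0 PX (fun n w => `|psi n (X n w) - fine 'E_(PY n)[psi n \o Y n]|))).
Proof.
move=> mX psdS [C opC] gY.
have SC n : forall j, Sigma n j j <= C := diag_le_opnorm (opC n).
have EE (psi : forall n, 'M[R]_(n, d) -> R) :
    (fun n w => `|psi n (X n w) - fine 'E_(PY n)[psi n \o Y n]|) =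
    (fun n w => `|psi n (X n w) - \int[PY n]_w psi n (Y n w)|).
  by apply: functional_extensionality_dep => n; rewrite unlock.
split=> [[dC [TC [PC [X' [Y' [cpl cvC]]]]]] r r1 psi lpsi|H].
  rewrite EE.
  exact: (pseudo_lipschitz_cvg_of_coupling psdS SC gY cpl cvC r1 lpsi).
have cvX (psi : forall n, 'M[R]_(n, d) -> R) :
    (forall n, pseudo_lipschitz 1 (psi n)) ->
    cvg_prob0 PX (fun n w => `|psi n (X n w) - \int[PY n]_w psi n (Y n w)|).
  by move=> lpsi; rewrite -EE; exact: (H 1 (lexx 1) psi lpsi).
have [P [marg cvP]] := coupling_exists mX psdS SC gY cvX.
exists _, (fun n => (TX n * TY n)%type), P, (fun n w => X n w.1),
  (fun n w => Y n w.2); split=> // n.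
have [m1 m2] := marg n; split; [|split; [|split]].
- by move=> i j; exact: (measurableT_comp (mX n i j) measurable_fst).
- by move=> i j; exact: (measurableT_comp ((gY n).1 i j) measurable_snd).
- move=> A mA; rewrite -m1; last exact: (measurable_random_mx (mX n) mA).
  by congr (P n _); apply/seteqP; split => w //= [].
- move=> A mA; rewrite -m2; last exact: (measurable_random_mx (gY n).1 mA).
  by congr (P n _); apply/seteqP; split => w //= [].
Qed.
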